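(* Let $\alpha\in\mathfrak S_n$ be a regular quasi-diagram, let $\zeta=(1\,2\cdots n)$, and let $A$ be the gentle algebra with one maximal path whose associated quasi-diagram is $\alpha$. For $j\in\{1,\dots,n-1\}$ let $g_j$ be the smallest positive integer such that $(\alpha\zeta)^{g_j}(j)$ equals $n$ or is an isolated point of $\alpha$, and let $g_n=0$. For $i\in\{1,\dots,n\}\setminus\{\alpha(n)\}$ let $d_i$ be the smallest positive integer such that $(\zeta\alpha)^{d_i}(i)$ is an isolated point of $\alpha$ or equals $\alpha(n)$, and let $d_{\alpha(n)}=0$. Then $$\operatorname{gldim}A=\max\{g_j\mid j\text{ is an isolated point of }\alpha\text{ or }j=\alpha(1)\}=\max\{d_i\mid i\text{ is an isolated point of }\alpha\text{ or }i=1\}.$$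
   Context: $k$ is an algebraically closed field of characteristic $0$; all algebras are over $k$ and basic. In a quiver $Q$, an arrow $a$ has source $s(a)$ and target $t(a)$; a path $a_1a_2\cdots a_l$ is composed from left to right, i.e. $t(a_i)=s(a_{i+1})$. An algebra $A$ is locally gentle if $A\cong kQ/I$ where: (1) $Q$ is a finite quiver such that at each vertex at most two arrows end and at most two arrows start; (2) $I$ is generated by paths of length two; (3) for every arrow $a$ there is at most one arrow $b$ such that $ab$ is a path in $I$ and at most one arrow $c$ such that $ca$ is a path in $I$, and there is at most one arrow $b'$ such that $ab'$ is a path not in $I$ and at most one arrow $c'$ such that $c'a$ is a path not in $I$. A gentle algebra is a finite-dimensional locally gentle algebra. A (nonzero) path in $A=kQ/I$ is a path $p$ of $Q$ (possibly trivial) with $p\notin I$; it is maximal if $pa=ap=0$ in $A$ for every arrow $a$. In a gentle algebra every arrow lies in a unique maximal path. ''Gentle algebra with one maximal path'' means that $A$ has exactly one maximal path $p$. If $p$ has length $n-1$ and passes successively through the vertices $v_1,\dots,v_n$ of $Q$ (each vertex of $Q$ occurs at most twice in this list), the associated permutation $\alpha\in\mathfrak S_n$ is given by $\alpha(i)=j$ if there is $j\ne i$ with $v_j=v_i$, and $\alpha(i)=i$ otherwise. This gives a bijection between isomorphism classes of gentle algebras with one maximal path and quasi-diagrams. Concretely, $A$ is the subalgebra of the path algebra of the linear quiver $1\to2\to\cdots\to n$ spanned by its radical and the elements $e_i+e_{\alpha(i)}$ ($\alpha(i)\neq i$) and $e_i$ ($\alpha(i)=i$), where $e_i$ is the idempotent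 at vertex $i$. A quasi-diagram is a permutation $\alpha\in\mathfrak S_n$ with $\alpha^2=\mathrm{id}$; its isolated points are its fixed points. It is regular if every orbit of $\zeta\alpha$ on $\{1,\dots,n\}$ contains $1$ or at least one isolated point of $\alpha$ (equivalently, every orbit of $\alpha\zeta$ contains $n$ or at least one isolated point of $\alpha$). Permutations are composed from right to left. *)

(* Defs.v *)
From HB Require Import structures.
From mathcomp Require Import all_boot all_order all_fingroup all_algebra all_field.
From mathcomp Require Import finmap.
From mathcomp Require Import monalg.

Set Implicit Arguments.
Unset Strict Implicit.
Unset Printing Implicit Defensive.

Import GRing.Theory.

Local Open Scope ring_scope.

Record quiver := Quiver {
  vertex : finType;
  arrow : finType;
  asrc : arrow -> vertex;
  atgt : arrow -> vertex }.

Fixpoint chain (Q : quiver) (v : vertex Q) (s : seq (arrow Q)) : bool :=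
  if s is a :: s' then (asrc a == v) && chain (atgt a) s' else true.

(* [(v, [:: a1; ...; al])] is the path a1 a2 ... al starting at v, composed
   from left to right; the trivial path at v is [(v, [::])]. *)
Record qpath (Q : quiver) := QPath {
  qpath_val :> vertex Q * seq (arrow Q);
  _ : chain qpath_val.1 qpath_val.2 }.

HB.instance Definition _ (Q : quiver) := [isSub for @qpath_val Q].
HB.instance Definition _ (Q : quiver) := [Choice of qpath Q by <:].

Section Paths.
Variable Q : quiver.
Implicit Types (v : vertex Q) (a : arrow Q) (p q : qpath Q).

Definition psrc p : vertex Q := (val p).1.
Definition parrows p : seq (arrow Q) := (val p).2.
Definition ptgt p : vertex Q := last (psrc p) (map (@atgt Q) (parrows p)).
Definition plength p : nat := size (parrows p).
Definition pvertices p : seq (vertex Q) := psrc p :: map (@atgt Q) (parrows p).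

Definition ptriv v : qpath Q := @QPath Q (v, [::]) isT.

Lemma chain_arrow a : chain (asrc a) [:: a].
Proof. by rewrite /= eqxx. Qed.

Definition parrow a : qpath Q := @QPath Q (asrc a, [:: a]) (chain_arrow a).

(* [None] stands for the zero product; when the end points match, [insub]
   always succeeds (lemma [pcompE]). *)
Definition pcomp p q : option (qpath Q) :=
  if ptgt p == psrc q then insub (psrc p, parrows p ++ parrows q) else None.

Lemma chain_cat v s t :
  chain v (s ++ t) = chain v s && chain (last v (map (@atgt Q) s)) t.
Proof. by elim: s v => //= a s IH v; rewrite IH andbA. Qed.

Lemma pcomp_chain p q :
  ptgt p = psrc q -> chain (psrc p) (parrows p ++ parrows q).
Proof. by move=> e; rewrite chain_cat (valP p) /= -/(ptgt p) e (valP q). Qed.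

Lemma pcompE p q (e : ptgt p = psrc q) :
  pcomp p q = Some (@QPath Q (psrc p, parrows p ++ parrows q) (pcomp_chain e)).
Proof.
rewrite /pcomp e eqxx; case: insubP => [u _ uE|]; last by rewrite /= pcomp_chain.
by congr Some; apply: val_inj.
Qed.

Lemma pcomp_none p q : ptgt p != psrc q -> pcomp p q = None.
Proof. by rewrite /pcomp => /negbTE ->. Qed.

Lemma pcomp_some p q r : pcomp p q = Some r ->
  [/\ ptgt p = psrc q, psrc r = psrc p, ptgt r = ptgt q
    & parrows r = parrows p ++ parrows q].
Proof.
case: (eqVneq (ptgt p) (psrc q)) => [e|ne]; last by rewrite pcomp_none.
rewrite (pcompE e) => -[<-]; split=> //.
by rewrite /ptgt /= map_cat last_cat -/(ptgt p) e.
Qed.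

Lemma qpath_inj p q : psrc p = psrc q -> parrows p = parrows q -> p = q.
Proof.
move=> e1 e2; apply: val_inj; move: e1 e2; rewrite /psrc /parrows.
by case: (val p) (val q) => [? ?] [? ?] /= -> ->.
Qed.

Lemma pcompA p q r :
  obind (fun s => pcomp s r) (pcomp p q) = obind (pcomp p) (pcomp q r).
Proof.
case epq: (pcomp p q) => [s|]; case eqr: (pcomp q r) => [t|] //=.
- have [e1 es1 et1 ea1] := pcomp_some epq.
  have [e2 es2 et2 ea2] := pcomp_some eqr.
  have e3 : ptgt s = psrc r by rewrite et1.
  have e4 : ptgt p = psrc t by rewrite es2.
  rewrite (pcompE e3) (pcompE e4); congr Some; apply: qpath_inj => //.
  by rewrite /parrows /= -!/(parrows _) ea1 ea2 catA.
- have [e1 es1 et1 ea1] := pcomp_some epq.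
  apply: pcomp_none; rewrite et1; apply/eqP => e.
  by rewrite (pcompE e) in eqr.
- have [e2 es2 et2 ea2] := pcomp_some eqr.
  rewrite pcomp_none // es2; apply/eqP => e.
  by rewrite (pcompE e) in epq.
Qed.

Lemma pcomp1p v p : pcomp (ptriv v) p = if v == psrc p then Some p else None.
Proof.
case: eqP => [e|/eqP ne]; last by rewrite pcomp_none.
have e' : ptgt (ptriv v) = psrc p by [].
by rewrite (pcompE e'); congr Some; apply: qpath_inj.
Qed.

Lemma pcompp1 v p : pcomp p (ptriv v) = if v == ptgt p then Some p else None.
Proof.
case: eqP => [e|/eqP ne]; last by rewrite pcomp_none // eq_sym.
have e' : ptgt p = psrc (ptriv v) by rewrite e.
by rewrite (pcompE e'); congr Some; apply: qpath_inj; rewrite // /parrows /= cats0.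
Qed.

End Paths.

Lemma malg_expand (k : fieldType) (K : choiceType) (f : {malg k[K]}) :
  f = \sum_(x <- msupp f) f@_x *: << x >>.
Proof.
rewrite [LHS]monalgE; apply: eq_bigr => x _.
by apply/malgP => y; rewrite mcoeffZ !mcoeffU mulrnAr mulr1.
Qed.

Definition path_alg (k : fieldType) (Q : quiver) : Type := {malg k[qpath Q]}.

HB.instance Definition _ (k : fieldType) (Q : quiver) :=
  GRing.Zmodule.copy (path_alg k Q) {malg k[qpath Q]}.
HB.instance Definition _ (k : fieldType) (Q : quiver) :=
  GRing.Zmodule_isLmodule.Build k (path_alg k Q)
    (@fgscaleA (qpath Q) k) (@fgscale1r (qpath Q) k)
    (@fgscaleDr (qpath Q) k) (@fgscaleDl (qpath Q) k).

HB.lock Definition pvec (k : fieldType) (Q : quiver) (p : qpath Q) :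
    path_alg k Q :=
  << p >>.

Definition pprod (k : fieldType) (Q : quiver) (p q : qpath Q) : path_alg k Q :=
  oapp (@pvec k Q) 0 (pcomp p q).

HB.lock Definition path_mul (k : fieldType) (Q : quiver) (f g : path_alg k Q) :
    path_alg k Q :=
  \sum_(p <- msupp f) \sum_(q <- msupp g) (f@_p * g@_q) *: pprod k p q.

Section PathAlgebra.
Variables (k : fieldType) (Q : quiver).
Implicit Types (f g h : path_alg k Q) (p q r : qpath Q) (d : {fset qpath Q}).

Local Notation pvec := (@pvec k Q).
Local Notation path_mul := (@path_mul k Q).

Definition path_one : path_alg k Q := \sum_(v : vertex Q) pvec (ptriv v).

Local Notation supp f := (msupp (f : {malg k[qpath Q]})).

Lemma path_mulw d1 d2 f g :
  (supp f `<=` d1)%fset -> (supp g `<=` d2)%fset ->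
  path_mul f g = \sum_(p <- d1) \sum_(q <- d2) (f@_p * g@_q) *: pprod k p q.
Proof.
move=> s1 s2; rewrite path_mul.unlock (big_fset_incl _ s1) /=.
  apply: eq_bigr => p _; apply: big_fset_incl => // q _ /mcoeff_outdom ->.
  by rewrite mulr0 scale0r.
move=> p _ /mcoeff_outdom ->.
by rewrite big1 // => q _; rewrite mul0r scale0r.
Qed.

Lemma path_mulDl : left_distributive path_mul +%R.
Proof.
move=> f g h.
rewrite [in RHS](@path_mulw (supp f `|` supp g)%fset (supp h) f h) ?fsubsetUl //.
rewrite [in RHS](@path_mulw (supp f `|` supp g)%fset (supp h) g h) ?fsubsetUr //.
rewrite (@path_mulw (supp f `|` supp g)%fset (supp h)) ?msuppD_le //.
rewrite -big_split; apply: eq_bigr => p _.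
rewrite -big_split; apply: eq_bigr => q _.
by rewrite mcoeffD mulrDl scalerDl.
Qed.

Lemma path_mulDr : right_distributive path_mul +%R.
Proof.
move=> h f g.
rewrite [in RHS](@path_mulw (supp h) (supp f `|` supp g)%fset h f) ?fsubsetUl //.
rewrite [in RHS](@path_mulw (supp h) (supp f `|` supp g)%fset h g) ?fsubsetUr //.
rewrite (@path_mulw (supp h) (supp f `|` supp g)%fset) ?msuppD_le //.
rewrite -big_split; apply: eq_bigr => p _.
rewrite -big_split; apply: eq_bigr => q _.
by rewrite mcoeffD mulrDr scalerDl.
Qed.

Lemma path_mulZl c f g : path_mul (c *: f) g = c *: path_mul f g.
Proof.
rewrite (@path_mulw (supp f) (supp g)) ?msuppZ_le // path_mul.unlock scaler_sumr.
apply: eq_bigr => p _; rewrite scaler_sumr; apply: eq_bigr => q _.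
by rewrite mcoeffZ -mulrA scalerA.
Qed.

Lemma path_mulZr c f g : path_mul f (c *: g) = c *: path_mul f g.
Proof.
rewrite (@path_mulw (supp f) (supp g)) ?msuppZ_le // path_mul.unlock scaler_sumr.
apply: eq_bigr => p _; rewrite scaler_sumr; apply: eq_bigr => q _.
by rewrite mcoeffZ mulrCA scalerA.
Qed.

Lemma path_mul0l f : path_mul 0 f = 0.
Proof. by rewrite -(scale0r (0 : path_alg k Q)) path_mulZl !scale0r. Qed.

Lemma path_mul0r f : path_mul f 0 = 0.
Proof. by rewrite -(scale0r (0 : path_alg k Q)) path_mulZr !scale0r. Qed.

Lemma path_mul_suml (I : Type) (s : seq I) (F : I -> path_alg k Q) g :
  path_mul (\sum_(i <- s) F i) g = \sum_(i <- s) path_mul (F i) g.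
Proof.
by apply: (big_morph (path_mul^~ g)) => [x y|]; rewrite ?path_mulDl ?path_mul0l.
Qed.

Lemma path_mul_sumr (I : Type) (s : seq I) (F : I -> path_alg k Q) g :
  path_mul g (\sum_(i <- s) F i) = \sum_(i <- s) path_mul g (F i).
Proof.
by apply: (big_morph (path_mul g)) => [x y|]; rewrite ?path_mulDr ?path_mul0r.
Qed.

Lemma path_mulU p q : path_mul (pvec p) (pvec q) = pprod k p q.
Proof.
rewrite pvec.unlock (@path_mulw [fset p]%fset [fset q]%fset) ?msuppU_le //.
by rewrite !big_seq_fset1 !mcoeffUU mulr1 scale1r.
Qed.

Lemma path_algE f : f = \sum_(p <- supp f) f@_p *: pvec p.
Proof.
rewrite [LHS]malg_expand; apply: eq_bigr => p _; congr (_ *: _).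
by rewrite pvec.unlock.
Qed.

Lemma path_alg_ind (P : path_alg k Q -> Prop) :
  P 0 -> (forall f g, P f -> P g -> P (f + g)) ->
  (forall c p, P (c *: pvec p)) -> forall f, P f.
Proof. by move=> P0 PD PZ f; rewrite (path_algE f); elim/big_ind: _. Qed.

Lemma path_mulA : associative path_mul.
Proof.
move=> f g h; elim/path_alg_ind: f => [|f1 f2 H1 H2|c1 p].
- by rewrite !path_mul0l.
- by rewrite !path_mulDl H1 H2.
rewrite !path_mulZl; congr (_ *: _).
elim/path_alg_ind: g => [|g1 g2 H1 H2|c2 q].
- by move: (pvec p) => x; rewrite path_mul0l !path_mul0r path_mul0l.
- move: (pvec p) H1 H2 => x H1 H2.
  by rewrite path_mulDl !path_mulDr path_mulDl H1 H2.
suff {c1 c2}: path_mul (pvec p) (path_mul (pvec q) h) =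
    path_mul (path_mul (pvec p) (pvec q)) h.
  move: (pvec p) (pvec q) => x y E.
  by rewrite (path_mulZl c2 y h) !(path_mulZr c2 x) path_mulZl E.
elim/path_alg_ind: h => [|h1 h2 H1 H2|c3 r].
- by move: (pvec p) (pvec q) => x y; rewrite !path_mul0r.
- move: (pvec p) (pvec q) H1 H2 => x y H1 H2.
  by rewrite !path_mulDr H1 H2.
suff {c3}: path_mul (pvec p) (path_mul (pvec q) (pvec r)) =
    path_mul (path_mul (pvec p) (pvec q)) (pvec r).
  by move: (pvec p) (pvec q) (pvec r) => x y z E; rewrite !path_mulZr E.
rewrite !path_mulU.
have := pcompA p q r; rewrite /pprod.
case: (pcomp p q) => [s|]; case: (pcomp q r) => [t|] /= e.
- by rewrite !path_mulU /pprod e.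
- by rewrite path_mulU path_mul0r /pprod e.
- by rewrite path_mulU path_mul0l /pprod -e.
- by rewrite path_mul0l path_mul0r.
Qed.

Lemma path_mul1l : left_id path_one path_mul.
Proof.
move=> f; rewrite {2}(path_algE f) [in LHS](path_algE f) path_mul_sumr.
apply: eq_bigr => p _; rewrite path_mulZr; congr (_ *: _).
rewrite path_mul_suml (bigD1 (psrc p)) //= big1 => [|v /negbTE vp].
  by rewrite path_mulU /pprod pcomp1p eqxx addr0.
by rewrite path_mulU /pprod pcomp1p vp.
Qed.

Lemma path_mul1r : right_id path_one path_mul.
Proof.
move=> f; rewrite {2}(path_algE f) [in LHS](path_algE f) path_mul_suml.
apply: eq_bigr => p _; rewrite path_mulZl; congr (_ *: _).
rewrite path_mul_sumr (bigD1 (ptgt p)) //= big1 => [|v /negbTE vp].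
  by rewrite path_mulU /pprod pcompp1 eqxx addr0.
by rewrite path_mulU /pprod pcompp1 vp.
Qed.

HB.instance Definition _ := GRing.Zmodule_isPzRing.Build (path_alg k Q)
  path_mulA path_mul1l path_mul1r path_mulDl path_mulDr.

End PathAlgebra.

Section Ideals.
Variable R : pzRingType.

Definition two_sided_ideal (I : R -> Prop) : Prop :=
  [/\ I 0, forall x y, I x -> I y -> I (x + y)
    & forall a x, I x -> I (a * x) /\ I (x * a)].

Definition ideal_gen (S : R -> Prop) (x : R) : Prop :=
  forall I : R -> Prop, two_sided_ideal I -> (forall y, S y -> I y) -> I x.

End Ideals.

Section Gentle.
Variables (k : fieldType) (Q : quiver).
Implicit Types (I : path_alg k Q -> Prop) (a b c : arrow Q).

Definition avec a : path_alg k Q := pvec k (parrow a).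

Definition composable a b : Prop := atgt a = asrc b.

Definition path_in I a b : Prop := composable a b /\ I (avec a * avec b).
Definition path_notin I a b : Prop := composable a b /\ ~ I (avec a * avec b).

Record locally_gentle_pair I : Prop := LocallyGentlePair {
  lg_in : forall v : vertex Q, (#|[set a | atgt a == v]| <= 2)%N;
  lg_out : forall v : vertex Q, (#|[set a | asrc a == v]| <= 2)%N;
  lg_gen : exists S : qpath Q -> Prop,
    (forall p, S p -> plength p = 2%N) /\
    (forall x, I x <-> ideal_gen (fun y => exists2 p, S p & y = pvec k p) x);
  lg_rel_r : forall a b b', path_in I a b -> path_in I a b' -> b = b';
  lg_rel_l : forall a c c', path_in I c a -> path_in I c' a -> c = c';
  lg_nrel_r : forall a b b', path_notin I a b -> path_notin I a b' -> b = b';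
  lg_nrel_l : forall a c c', path_notin I c a -> path_notin I c' a -> c = c' }.

Definition maximal_path I (p : qpath Q) : Prop :=
  ~ I (pvec k p) /\
  forall a, I (pvec k p * avec a) /\ I (avec a * pvec k p).

(* The n.+1 vertices v_1, ..., v_(n.+1) of p are indexed from 0: v_i is [v]
   at the ordinal i - 1 : 'I_n.+1. *)
Definition associated_perm (n : nat) (p : qpath Q) (alpha : 'S_n.+1) : Prop :=
  let v (i : 'I_n.+1) := nth (psrc p) (pvertices p) i in
  plength p = n /\
  forall i, (forall j, j != i -> v j = v i -> alpha i = j) /\
            ((forall j, j != i -> v j <> v i) -> alpha i = i).

(* A is isomorphic to kQ/I: there is a surjective morphism of k-algebras
   kQ -> A with kernel I. *)
Definition presents I (A : algType k) : Prop :=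
  exists phi : {rmorphism path_alg k Q -> A},
    [/\ scalable phi, (forall y, exists x, phi x = y)
      & forall x, phi x = 0 <-> I x].

End Gentle.

(* [falgType k] is the type of finite-dimensional k-algebras, so the locally
   gentle algebra A below is gentle. *)
Definition gentle_one_maximal_path (k : fieldType) (A : falgType k)
    (n : nat) (alpha : 'S_n.+1) : Prop :=
  exists (Q : quiver) (I : path_alg k Q -> Prop),
    [/\ locally_gentle_pair I, presents I A
      & exists p : qpath Q,
          [/\ maximal_path I p, (forall q, maximal_path I q -> q = p)
            & associated_perm p alpha]].

Definition surjective (X Y : Type) (f : X -> Y) : Prop :=
  forall y, exists x, f x = y.

Definition projective (R : pzRingType) (P : lmodType R) : Prop :=
  forall (M N : lmodType R) (g : {linear M -> N}) (f : {linear P -> N}),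
    surjective g -> exists h : {linear P -> M}, forall x, g (h x) = f x.

(* M has a projective resolution 0 -> P_d -> ... -> P_1 -> P_0 -> M -> 0. *)
Definition pdim_le (R : pzRingType) (M : lmodType R) (d : nat) : Prop :=
  exists (P : nat -> lmodType R) (del : forall i, {linear P i.+1 -> P i})
         (eps : {linear P 0%N -> M}),
    [/\ forall i, projective (P i),
        surjective eps,
        forall x, eps x = 0 <-> exists y, del 0%N y = x,
        forall i x, del i x = 0 <-> exists y, del i.+1 y = x
      & forall i, (d < i)%N -> forall x : P i, x = 0].

(* gldim R = d: d is the least upper bound of the projective dimensions of all
   left R-modules. For the finite-dimensional algebras considered here, left and
   right global dimensions agree. *)
Definition gldim_is (R : pzRingType) (d : nat) : Prop :=
  (forall M : lmodType R, pdim_le M d) /\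
  (forall d', (forall M : lmodType R, pdim_le M d') -> (d <= d')%N).

Section QuasiDiagrams.
Variable n : nat.
Implicit Types (alpha : 'S_n.+1) (i j : 'I_n.+1).

(* The cycle (1 2 ... n.+1), with 1 read as [ord0] and n.+1 as [ord_max]. *)
Definition zeta : 'S_n.+1 := perm (@ordS_inj n.+1).

Definition quasi_diagram alpha : Prop := forall i, alpha (alpha i) = i.

Definition isolated alpha i : bool := alpha i == i.

(* [\o] composes from right to left, unlike the product of 'S_n.+1. *)
Definition zeta_alpha alpha : 'I_n.+1 -> 'I_n.+1 := zeta \o alpha.
Definition alpha_zeta alpha : 'I_n.+1 -> 'I_n.+1 := alpha \o zeta.

Definition regular alpha : Prop :=
  forall i, exists2 x, x \in fingraph.orbit (zeta_alpha alpha) i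
                     & (x == ord0) || isolated alpha x.

Definition smallest_positive (P : nat -> Prop) (m : nat) : Prop :=
  [/\ (0 < m)%N, P m & forall m', (0 < m')%N -> P m' -> (m <= m')%N].

Definition g_spec alpha (g : 'I_n.+1 -> nat) : Prop :=
  g ord_max = 0%N /\
  forall j, j != ord_max ->
    smallest_positive
      (fun m => let x := iter m (alpha_zeta alpha) j in
                x = ord_max \/ isolated alpha x) (g j).

Definition d_spec alpha (d : 'I_n.+1 -> nat) : Prop :=
  d (alpha ord_max) = 0%N /\
  forall i, i != alpha ord_max ->
    smallest_positive
      (fun m => let x := iter m (zeta_alpha alpha) i in
                isolated alpha x \/ x = alpha ord_max) (d i).

End QuasiDiagrams.

(* Main.v *)
Require Import Defs.
From HB Require Import structures.
From mathcomp Require Import all_boot all_order all_fingroup all_algebra all_field.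
From mathcomp Require Import boolp classical_sets zify.
From mathcomp Require finmap monalg.

Set Implicit Arguments.
Unset Strict Implicit.
Unset Printing Implicit Defensive.

Import GRing.Theory.
Local Open Scope ring_scope.

(** Let [p] be the maximal path, through the positions 0, ..., n.  Every path
    that is nonzero in A is a subpath of [p], so sending a linear combination
    of paths to the matrix whose (i, j) entry is the coefficient of the subpath
    of [p] from i to j identifies A with the algebra of upper triangular
    matrices X with X_(ii) = X_(jj) whenever j = alpha(i)
    ([gentle_tri_rep]).  From there on only this matrix description is used.

    The ideal of A is generated by paths of length two, and A is Koszul: every
    left module M has the resolution
      P_m = sum over c of  A e_c (tensor over k) e_t M,
    where c runs over the first positions of the chains a_1 a_2 ... a_m of
    arrows with all consecutive products zero (over the vertices if m = 0), and t
    is the end of the chain.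
    If an arrow starts at the position c, the only arrow that follows it with
    product zero starts at the position alpha(zeta(c)), and it exists precisely
    when zeta(c) is not isolated and alpha(zeta(c)) is not the last position.
    Hence a chain of length m starts at c exactly when m <= g c, and P_m
    vanishes once m exceeds all the g c.  The differential is
      x a_1...a_m y |-> x a_1 (a_2...a_m) y + (-1)^m x (a_1...a_(m-1)) a_m y.
    In coordinates, each P_m with m >= 1 splits as N_m + N_(m+1), and the
    differential restricts to the identity between the two copies of N_(m+1);
    this makes exactness transparent ([kexact_lift]).  It follows that every
    module has projective dimension at most max g ([pdim_le_koszul]).

    Conversely, if M is simple then all differentials land in the radical.  Were
    there a shorter projective resolution, comparing the two would give a
    contraction of the Koszul resolution in a degree where it is nonzero
    ([res_contraction]), so a nonzero P_m would equal its radical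
    ([pdim_simple]).  Thus gldim A is the maximum of g over all positions.

    That maximum is attained at an isolated position or at alpha(0), because
    from any other position c one can step back to a position whose g is larger
    by one ([max_g_starts]).  Finally alpha conjugates alpha zeta to zeta alpha
    and fixes the isolated points, so d = g after alpha ([d_g_alpha]), which
    turns one maximum into the other. *)

(** * Projective resolutions and their comparison *)

Section Image.
Variables (R : pzRingType) (X Y : lmodType R) (g : {linear X -> Y}).

Definition in_image : {pred Y} := [pred y | `[< exists x, g x = y >]].

Fact in_image_submod : GRing.submod_closed in_image.
Proof.
split=> [|a u v]; first by apply/asboolP; exists 0; rewrite raddf0.
move=> /asboolP [x <-] /asboolP [y <-]; apply/asboolP; exists (a *: x + y).
by rewrite linearP.
Qed.
HB.instance Definition _ := GRing.isSubmodClosed.Build R Y in_image in_image_submod.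

Record image := Image { image_val :> Y; _ : image_val \in in_image }.
HB.instance Definition _ := [isSub for image_val].
HB.instance Definition _ := [Choice of image by <:].
HB.instance Definition _ := [SubChoice_isSubLmodule of image by <:].

Variables (Z : lmodType R) (f : {linear Z -> Y}).
Hypothesis fg : forall z, exists x, g x = f z.

Fact corestrict_subproof z : f z \in in_image.
Proof. exact/asboolP. Qed.
Definition corestrict z := Image (corestrict_subproof z).

Fact corestrict_linear : linear corestrict.
Proof. by move=> a u v; apply: val_inj; rewrite /= linearP. Qed.
HB.instance Definition _ := GRing.isLinear.Build R Z image _ corestrict corestrict_linear.
End Image.

Section Homological.
Variable R : pzRingType.

(** Projectivity only speaks of surjections, so [g] is first corestricted to its
    image. *)
Lemma projective_lift (P X Y : lmodType R) (g : {linear X -> Y})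
    (f : {linear P -> Y}) :
  projective P -> (forall p, exists x, g x = f p) ->
  exists h : {linear P -> X}, forall p, g (h p) = f p.
Proof.
move=> projP gf.
have gg x : exists y, g y = g x by exists x.
have [|h hE] := projP X _ (corestrict gg) (corestrict gf).
  by move=> [y /[dup] /asboolP [x <-] yP]; exists x; apply: val_inj.
by exists h => p; have /(congr1 val) := hE p.
Qed.

Record resolution (M : lmodType R) := Resolution {
  res_mod :> nat -> lmodType R;
  res_d : forall i, {linear res_mod i.+1 -> res_mod i};
  res_aug : {linear res_mod 0%N -> M};
  res_proj : forall i, projective (res_mod i);
  res_surj : surjective res_aug;
  res_exact0 : forall x, res_aug x = 0 <-> exists y, res_d 0 y = x;
  res_exact : forall i x, res_d i x = 0 <-> exists y, res_d i.+1 y = x }.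

Lemma pdim_leP (M : lmodType R) d :
  pdim_le M d <->
  exists r : resolution M, forall i, (d < i)%N -> forall x : r i, x = 0.
Proof.
split=> [[P [del [eps [h1 h2 h3 h4 h5]]]]|[r r0]].
  by exists (Resolution h1 h2 h3 h4).
by exists r, (res_d r), (res_aug r); split=> //; case: r r0.
Qed.

(** Chain maps and homotopies are built one degree at a time; each [T i] below
    carries the condition that makes the next step possible. *)
Lemma dependent_recursion (T : nat -> Type) (E : forall i, T i -> T i.+1 -> Prop) :
  T 0%N -> (forall i (f : T i), exists f', E i f f') ->
  exists F : forall i, T i, forall i, E i (F i) (F i.+1).
Proof.
move=> f0 step; pose next i f := cid (step i f).
exists (nat_rect T f0 (fun i f => projT1 (next i f))) => i /=.
exact: (projT2 (next i _)).
Qed.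

Section Comparison.
Variables (M : lmodType R) (P Q : resolution M).
Local Notation dP := (res_d P).
Local Notation dQ := (res_d Q).

Lemma res_dd i x : dQ i (dQ i.+1 x) = 0.
Proof. by apply/res_exact; exists x. Qed.

Lemma res_augd x : res_aug Q (dQ 0 x) = 0.
Proof. by apply/res_exact0; exists x. Qed.

(** The condition carried along is that the map so far sends boundaries to
    boundaries, which exactness turns into a commuting square. *)
Lemma res_chain_map :
  exists f : forall i, {linear Q i -> P i},
    (forall x, res_aug P (f 0%N x) = res_aug Q x) /\
    forall i x, dP i (f i.+1 x) = f i (dQ i x).
Proof.
pose T i := {f : {linear Q i -> P i} |
  (forall x : Q i.+1, exists y, dP i y = f (dQ i x)) /\
  (match i return {linear Q i -> P i} -> Prop with
   | 0 => fun f => forall x, res_aug P (f x) = res_aug Q x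
   | _ => fun=> True end f)}.
have f0 : T 0%N.
  apply: cid; have [|f fE] := @projective_lift _ _ _ (res_aug P) (res_aug Q) (@res_proj _ Q 0).
    by move=> q; apply: res_surj.
  by exists f; split=> // x; apply/res_exact0; rewrite fE res_augd.
have [|F FE] := @dependent_recursion T
    (fun i f f' => forall x, dP i (sval f' x) = sval f (dQ i x)) f0.
  move=> i [f [fP f0']] /=.
  have [h hE] := @projective_lift _ _ _ (dP i) (f \o dQ i) (@res_proj _ Q i.+1) fP.
  have hP : forall x, exists y, dP i.+1 y = h (dQ i.+1 x).
    by move=> x; apply/res_exact; rewrite hE /= res_dd raddf0.
  by exists (exist _ h (conj hP I)).
exists (fun i => sval (F i)); split=> //.
by case: (svalP (F 0%N)).
Qed.

(** A chain endomorphism over the zero map of M is null-homotopic; this is the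
    uniqueness half of the comparison theorem. *)
Lemma res_null_homotopy (th : forall i, {linear Q i -> Q i}) :
  (forall x, res_aug Q (th 0%N x) = 0) ->
  (forall i x, dQ i (th i.+1 x) = th i (dQ i x)) ->
  exists h : forall i, {linear Q i -> Q i.+1},
    forall i x, th i.+1 x = dQ i.+1 (h i.+1 x) + h i (dQ i x).
Proof.
move=> th0 thd.
pose T i := {h : {linear Q i -> Q i.+1} |
  forall x : Q i.+1, exists y, dQ i.+1 y = th i.+1 x - h (dQ i x)}.
have h0 : T 0%N.
  apply: cid; have [|h hE] := @projective_lift _ _ _ (dQ 0) (th 0%N) (@res_proj _ Q 0).
    by move=> q; apply/res_exact0.
  by exists h => x; apply/res_exact; rewrite raddfB /= hE thd subrr.
have [|H HE] := @dependent_recursion T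
    (fun i h h' => forall x, dQ i.+1 (sval h' x) = th i.+1 x - sval h (dQ i x)) h0.
  move=> i [h hP] /=.
  have [|h' hE] := @projective_lift _ _ _ (dQ i.+1) (th i.+1 \- (h \o dQ i)) (@res_proj _ Q i.+1).
    by move=> x; have [y yE] := hP x; exists y.
  have hP' : forall x, exists y, dQ i.+2 y = th i.+2 x - h' (dQ i.+1 x).
    by move=> x; apply/res_exact; rewrite raddfB /= hE /= thd res_dd raddf0 subr0 subrr.
  by exists (exist _ h' hP').
by exists (fun i => sval (H i)) => i x; rewrite HE subrK.
Qed.

End Comparison.

(** Going to the short resolution and back is homotopic to the identity, and it
    factors through zero in the degrees where the short one vanishes. *)
Lemma res_contraction (M : lmodType R) (P Q : resolution M) d :
  (forall i, (d < i)%N -> forall x : P i, x = 0) ->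
  exists h : forall i, {linear Q i -> Q i.+1},
    forall i, (d <= i)%N -> forall x : Q i.+1,
      x = res_d Q i.+1 (h i.+1 x) + h i (res_d Q i x).
Proof.
move=> P0; have [f [fa fd]] := res_chain_map P Q; have [g [ga gd]] := res_chain_map Q P.
have [||h hE] := @res_null_homotopy M Q (fun i => [the {linear Q i -> Q i} of idfun \- (g i \o f i)]).
- by move=> x; rewrite raddfB /= ga fa subrr.
- by move=> i x; rewrite raddfB /= gd fd.
exists h => i di x; rewrite -hE /=.
by have -> : f i.+1 x = 0 by [exact: P0]; rewrite raddf0 subr0.
Qed.

End Homological.

Section SemilinearSection.
Variables (k : fieldType) (A : algType k) (M N : lmodType A) (g : {linear M -> N}).

Let subspace (W : set M) :=
  [/\ W 0, forall x y, W x -> W y -> W (x + y) & forall c x, W x -> W (c%:A *: x)].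

(** A k-linear, in general not A-linear, section of a surjection of A-modules;
    the base field acts through the scalars [x%:A].  The image of the section is
    a complement of the kernel of [g], obtained as a maximal subspace meeting
    that kernel trivially. *)
Lemma scalar_section : surjective g ->
  exists s : N -> M, [/\ forall x, g (s x) = x, forall x y, s (x + y) = s x + s y
    & forall c x, s (c%:A *: x) = c%:A *: s x].
Proof.
move=> gsurj.
have [|W [[W0 Wker] Wmax]] :=
    @Zorn_bigcup M (fun W => subspace (0 |` W)%classic /\ forall x, W x -> g x = 0 -> x = 0).
  move=> F FP Ftot; split; last by move=> x [W /FP[_ Wk] Wx]; apply: Wk.
  split; first by left.
  - move=> x y [->|[X FX Xx]]; first by rewrite add0r.
    move=> [->|[Y FY Yy]]; first by rewrite addr0; right; exists X.
    wlog XY : x y X Y FX FY Xx Yy / (X `<=` Y)%classic.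
      move=> W; case: (Ftot X Y FX FY) => h; first exact: (W x y X Y).
      by rewrite addrC; apply: (W y x Y X).
    have [[_ YD _] _] := FP _ FY.
    have [|] := YD x y (or_intror (XY _ Xx)) (or_intror Yy); first by left.
    by right; exists Y.
  move=> c x [->|[X FX Xx]]; first by left; rewrite scaler0.
  have [[_ _ XZ] _] := FP _ FX.
  have [|] := XZ c x (or_intror Xx); first by left.
  by right; exists X.
set W' := (0 |` W)%classic in W0; have [W00 WD WZ] := W0.
have W'ker x : W' x -> g x = 0 -> x = 0 by case=> [//|]; apply: Wker.
have W'W : W = W'.
  apply: contrapT => neq; apply: (Wmax W').
    split; first by move=> x Wx; right.
    by move=> h; apply: neq; apply/seteqP; split=> // x Wx; right.
  split=> //; suff -> : (0 |` W')%classic = W' by [].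
  by apply/seteqP; split=> x; [case=> [->|//]; left|right].
have WN x : W' x -> W' (- x).
  by move=> /(WZ (- 1)); rewrite scaleN1r scaleNr scale1r.
have gW y : exists2 w, W' w & g w = g y.
  case: (pselect (exists2 w, W' w & g w = g y)) => // no; exfalso.
  (* a vector not reached by the complement would allow enlarging it by a line *)
  pose V := [set x | exists w c, W' w /\ x = w + c%:A *: y]%classic.
  have V0 : V 0 by exists 0, 0; rewrite scale0r scale0r addr0.
  apply: (Wmax V); first split.
  - by move=> x Wx; exists x, 0; rewrite !scale0r addr0; split=> //; right.
  - move=> /(_ y) VW; apply: no; exists y => //; rewrite -W'W; apply: VW.
    by exists 0, 1; rewrite !scale1r add0r.
  split.
    have -> : (0 |` V = V)%classic by apply/seteqP; split=> x; [case=> [->|]|right].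
    split=> // [x z|c x].
      move=> [w [c [Ww ->]]] [w' [c' [Ww' ->]]]; exists (w + w'), (c + c').
      by split; [apply: WD|rewrite !scalerDl addrACA].
    move=> [w [c' [Ww ->]]]; exists (c%:A *: w), (c * c'); split; first exact: WZ.
    by rewrite scalerDr scalerA -scalerAl mul1r scalerA.
  move=> x [w [c [Ww ->]]]; rewrite linearD linearZ /=.
  have [->|c0 /eqP] := eqVneq c 0.
    by rewrite !scale0r !addr0; apply: W'ker.
  rewrite addrC addr_eq0 => /eqP h; exfalso; apply: no.
  exists (c^-1%:A *: - w); first exact/WZ/WN.
  by rewrite linearZ linearN /= -h scalerA -scalerAl mul1r scalerA mulVf // !scale1r.
have ex x : exists w, W' w /\ g w = x.
  by have [y <-] := gsurj x; have [w] := gW y; exists w.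
pose s x := projT1 (cid (ex x)).
have sW x : W' (s x) by rewrite /s; case: cid => w [].
have gs x : g (s x) = x by rewrite /s; case: cid => w [].
have uniq_W x y : W' x -> W' y -> g x = g y -> x = y.
  move=> Wx Wy gxy; apply/eqP; rewrite -subr_eq0; apply/eqP/W'ker.
    exact/WD/WN.
  by rewrite linearB /= gxy subrr.
exists s; split=> // [x y|c x]; apply: uniq_W; try exact: WD; try exact: WZ; try exact: sW.
  by rewrite linearD /= !gs.
by rewrite linearZ /= !gs.
Qed.

End SemilinearSection.

(** * Coefficients in the path algebra *)

Section Subpaths.
Variable Q : quiver.
Implicit Types (q r : qpath Q) (a : arrow Q).

Fact psub_chain q i j :
  chain (last (psrc q) (map (@atgt Q) (take i (parrows q))))
    (take (j - i) (drop i (parrows q))).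
Proof.
set s := parrows q; have : chain (psrc q) s := valP q.
rewrite -{1}(cat_take_drop i s) chain_cat => /andP[_].
by rewrite -{1}(cat_take_drop (j - i) (drop i s)) chain_cat => /andP[].
Qed.
(** The segment of [q] between its [i]-th and [j]-th vertices, counted from 0. *)
Definition psub q i j : qpath Q := @QPath Q (_, _) (psub_chain q i j).

Lemma psrc_psub q i j :
  psrc (psub q i j) = last (psrc q) (map (@atgt Q) (take i (parrows q))).
Proof. by []. Qed.

Lemma parrows_psub q i j : parrows (psub q i j) = take (j - i) (drop i (parrows q)).
Proof. by []. Qed.

Lemma plength_psub q i j :
  (i <= j <= plength q)%N -> plength (psub q i j) = (j - i)%N.
Proof.
case/andP=> ij jq; rewrite /plength parrows_psub size_take size_drop.
by rewrite -/(plength q); case: ltnP => //; lia.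
Qed.

Lemma psub_full q : psub q 0 (plength q) = q.
Proof.
by apply: qpath_inj; rewrite ?psrc_psub ?parrows_psub ?take0 // drop0 subn0 take_size.
Qed.

Lemma ptgt_psub q i j : (i <= j)%N ->
  ptgt (psub q i j) = last (psrc q) (map (@atgt Q) (take j (parrows q))).
Proof.
move=> ij; rewrite /ptgt psrc_psub parrows_psub -last_cat -map_cat.
by rewrite -takeD subnKC.
Qed.

Lemma pcomp_psub q i l j : (i <= l <= j)%N ->
  Defs.pcomp (psub q i l) (psub q l j) = Some (psub q i j).
Proof.
case/andP=> il lj.
have e : ptgt (psub q i l) = psrc (psub q l j) by rewrite ptgt_psub.
rewrite (pcompE e); congr Some; apply: qpath_inj => //.
change (parrows (psub q i l) ++ parrows (psub q l j) = parrows (psub q i j)).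
rewrite !parrows_psub; have -> : (j - i = (l - i) + (j - l))%N by lia.
by rewrite takeD drop_drop subnK.
Qed.

Lemma psub_psub q i j i' j' : (i' <= j' <= j - i)%N ->
  psub (psub q i j) i' j' = psub q (i + i') (i + j').
Proof.
case/andP=> ij jj; apply: qpath_inj.
  rewrite !psrc_psub parrows_psub -last_cat -map_cat take_takel; last by lia.
  by rewrite -takeD.
rewrite !parrows_psub subnDl (addnC i) -drop_drop !(take_drop (j' - i')) subnK //.
by rewrite take_takel.
Qed.

Lemma pcomp_split p r q : Defs.pcomp p r = Some q ->
  p = psub q 0 (plength p) /\ r = psub q (plength p) (plength q).
Proof.
move=> /pcomp_some [e es et ea].
have ap : take (plength p) (parrows q) = parrows p by rewrite ea take_size_cat.
split; apply: qpath_inj; rewrite ?psrc_psub ?parrows_psub ?take0 //=.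
- by rewrite drop0 subn0 ap.
- by rewrite ap es -e.
by rewrite ea drop_size_cat // /plength ea size_cat addKn take_size.
Qed.

End Subpaths.

Section Coefficients.
Variables (k : fieldType) (Q : quiver).
Implicit Types (f g : path_alg k Q) (p q r : qpath Q).

Definition coef f q : k := monalg.mcoeff q f.

Lemma coefD f g q : coef (f + g) q = coef f q + coef g q.
Proof. exact: monalg.mcoeffD. Qed.

Lemma coef0 q : coef 0 q = 0.
Proof. exact: monalg.mcoeff0. Qed.

Lemma coef_sum (J : Type) (s : seq J) (P : pred J) (F : J -> path_alg k Q) q :
  coef (\sum_(j <- s | P j) F j) q = \sum_(j <- s | P j) coef (F j) q.
Proof. by elim/big_ind2: _ => [|? ? ? ? <- <-|//]; rewrite ?coef0 ?coefD. Qed.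

Lemma coefZ c f q : coef (c *: f) q = c * coef f q.
Proof. exact: monalg.mcoeffZ. Qed.

Lemma coef_pvec p q : coef (pvec k p) q = (p == q)%:R.
Proof. by rewrite /coef pvec.unlock monalg.mcoeffU mulrb. Qed.

Lemma coef_oapp (o : option (qpath Q)) q :
  coef (oapp (@pvec k Q) 0 o) q = (o == Some q)%:R.
Proof. by case: o => [p|] /=; rewrite ?coef_pvec ?coef0. Qed.

(** The factorizations of [q] as a product of two paths are its cuttings at one
    of its vertices. *)
Lemma coef_mul f g q :
  coef (f * g) q =
  \sum_(l < (plength q).+1) coef f (psub q 0 l) * coef g (psub q l (plength q)).
Proof.
elim/path_alg_ind: f => [|f1 f2 H1 H2|c p].
- by rewrite mul0r coef0 big1 // => l _; rewrite coef0 mul0r.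
- rewrite mulrDl coefD H1 H2 -big_split; apply: eq_bigr => l _.
  by rewrite coefD mulrDl.
have -> : (c *: pvec k p) * g = c *: (pvec k p * g : path_alg k Q) by exact: path_mulZl.
suff E : coef (pvec k p * g) q = \sum_(l < (plength q).+1)
    coef (pvec k p) (psub q 0 l) * coef g (psub q l (plength q)).
  rewrite [LHS]coefZ E mulr_sumr; apply: eq_bigr => l _.
  by rewrite [in RHS]coefZ mulrA.
elim/path_alg_ind: g => [|g1 g2 H1 H2|{}c r].
- by rewrite mulr0 coef0 big1 // => l _; rewrite coef0 mulr0.
- rewrite mulrDr coefD H1 H2 -big_split; apply: eq_bigr => l _.
  by rewrite coefD mulrDr.
have -> : pvec k p * (c *: pvec k r) = c *: Defs.pprod k p r.
  by rewrite -path_mulU; exact: path_mulZr.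
rewrite [LHS]coefZ coef_oapp.
have [e|ne] := eqVneq (Defs.pcomp p r) (Some q).
  have [e1 e2] := pcomp_split e.
  have pq : (plength p < (plength q).+1)%N.
    have [_ _ _ ea] := pcomp_some e.
    by rewrite ltnS /plength ea size_cat leq_addr.
  rewrite (bigD1 (Ordinal pq)) //= big1 => [|l ne].
    by rewrite coefZ !coef_pvec -e1 -e2 !eqxx addr0 mul1r.
  rewrite coef_pvec; case: eqP => [E|]; last by rewrite mul0r.
  case/eqP: ne; apply: val_inj => /=.
  by rewrite E plength_psub ?subn0 //= -ltnS.
rewrite mulr0 big1 // => l _; rewrite coefZ !coef_pvec.
case: eqP => [E1|]; last by rewrite mul0r.
case: eqP => [E2|]; last by rewrite !mulr0.
case/negP: ne; apply/eqP; rewrite E1 E2 pcomp_psub ?psub_full //=.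
by rewrite -ltnS.
Qed.

Lemma coef1 q : coef 1 q = (plength q == 0%N)%:R.
Proof.
have -> : 1 = path_one k Q by [].
rewrite coef_sum (bigD1 (psrc q)) //= big1 => [|v ne].
  rewrite coef_pvec addr0; congr (_%:R); congr nat_of_bool.
  apply/eqP/eqP => [<- //|/size0nil e]; exact: qpath_inj.
by rewrite coef_pvec; case: eqP => // E; rewrite -E eqxx in ne.
Qed.

Lemma path_alg_supp_ind (P : path_alg k Q -> Prop) f :
  P 0 -> (forall x y, P x -> P y -> P (x + y)) ->
  (forall q, coef f q != 0 -> P (coef f q *: pvec k q)) -> P f.
Proof.
move=> P0 PD Pf; rewrite (path_algE f) big_seq.
elim/big_ind: _ => // q; rewrite -monalg.mcoeff_neq0; exact: Pf.
Qed.

Lemma pvec_psub q i l j : (i <= l <= j)%N ->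
  pvec k (psub q i j) = pvec k (psub q i l) * pvec k (psub q l j).
Proof.
move=> ilj; have <- : Defs.pprod k (psub q i l) (psub q l j) = pvec k (psub q i j).
  by rewrite /Defs.pprod pcomp_psub.
by symmetry; exact: path_mulU.
Qed.

End Coefficients.

(** * A gentle algebra with one maximal path as an algebra of matrices *)

(** A faithful description of A by upper triangular matrices: [rho_arr] and
    [rho_idem] say that the image is the whole algebra of upper triangular
    matrices with equal diagonal entries at [i] and [alpha i]. *)
Record tri_rep (k : fieldType) (A : algType k) n (alpha : 'S_n.+1) := TriRep {
  rho :> {rmorphism A -> 'M[k]_n.+1};
  rhoZ : forall c a, rho (c *: a) = c *: rho a;
  rho_inj : injective rho;
  rho_tri : forall a (i j : 'I_n.+1), (j < i)%N -> rho a i j = 0;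
  rho_diag : forall a i, rho a (alpha i) (alpha i) = rho a i i;
  rho_arr : forall i j : 'I_n.+1, (i < j)%N -> exists a, rho a = delta_mx i j;
  rho_idem : forall i, exists a,
    rho a = \matrix_(r, s) ((r == s) && ((r == i) || (r == alpha i)))%:R }.

Section MonomialIdeal.
Variables (k : fieldType) (Q : quiver) (I : path_alg k Q -> Prop).
Variable S : qpath Q -> Prop.
Hypothesis S_length : forall p, S p -> plength p = 2%N.
Hypothesis I_gen :
  forall x, I x <-> ideal_gen (fun y => exists2 p, S p & y = pvec k p) x.
Implicit Types (f : path_alg k Q) (p q r : qpath Q) (a b : arrow Q).

Definition has_rel q := exists i, (i.+2 <= plength q)%N /\ S (psub q i i.+2).

Lemma I_ideal : two_sided_ideal I.
Proof.
split=> [|x y /I_gen Ix /I_gen Iy|a x /I_gen Ix].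
- by apply/I_gen => J [].
- by apply/I_gen => J idJ SJ; case: (idJ) => _ + _; apply; [apply: Ix|apply: Iy].
by split; apply/I_gen => J idJ SJ; case: (idJ) => _ _ /(_ a x (Ix J idJ SJ)) [].
Qed.

Lemma ideal0 : I 0. Proof. by case: I_ideal. Qed.
Lemma idealD x y : I x -> I y -> I (x + y). Proof. by case: I_ideal => _ + _; apply. Qed.
Lemma idealMl x y : I y -> I (x * y). Proof. by case: I_ideal => _ _ h /(h x) []. Qed.
Lemma idealMr x y : I x -> I (x * y). Proof. by case: I_ideal => _ _ h /(h y) []. Qed.

Lemma idealZ c x : I x -> I (c *: x).
Proof.
have -> : c *: x = (c *: (1 : path_alg k Q) : path_alg k Q) * x.
  by rewrite -[in LHS](mul1r x); symmetry; exact: path_mulZl.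
exact: idealMl.
Qed.

Lemma has_rel_psub q i j : (i <= j <= plength q)%N ->
  has_rel (psub q i j) -> has_rel q.
Proof.
move=> ijq [l []]; rewrite plength_psub // => lj.
rewrite psub_psub; last by lia.
by rewrite !addnS => Sl; exists (i + l)%N; split=> //; lia.
Qed.

(** The elements supported on paths with a relation form a two-sided ideal, since
    a relation in a segment of a path is a relation in the path.  It contains the
    generators of I. *)
Lemma I_has_rel f : I f -> forall r, coef f r != 0 -> has_rel r.
Proof.
move=> /I_gen /(_ (fun f => forall r, coef f r != 0 -> has_rel r)); apply; last first.
  move=> y [p Sp ->] r; rewrite coef_pvec; case: (p =P r) => [<- _|]; last by rewrite eqxx.
  exists 0%N; rewrite (S_length Sp); split=> //.
  by have := psub_full p; rewrite (S_length Sp) => ->.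
split=> [r|x y Jx Jy r|a x Jx]; first by rewrite coef0 eqxx.
  rewrite coefD => ne; have [x0|/Jx//] := eqVneq (coef x r) 0.
  by apply: Jy; rewrite x0 add0r in ne.
split=> r; rewrite coef_mul => ne; apply: contrapT => nr; case/eqP: ne.
  apply: big1 => l _; have [->|/Jx h] := eqVneq (coef x (psub r l (plength r))) 0.
    by rewrite mulr0.
  by case: nr; apply: has_rel_psub h; rewrite leqnn andbT -ltnS.
apply: big1 => l _; have [->|/Jx h] := eqVneq (coef x (psub r 0 l)) 0.
  by rewrite mul0r.
by case: nr; apply: has_rel_psub h; rewrite /= -ltnS.
Qed.

Lemma has_relP q : I (pvec k q) <-> has_rel q.
Proof.
split=> [/I_has_rel|[i [iq Si]]].
  by apply; rewrite coef_pvec eqxx oner_eq0.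
rewrite -(psub_full q) (@pvec_psub _ _ q 0 i.+2); last by lia.
apply: idealMr; rewrite (@pvec_psub _ _ q 0 i); last by lia.
by apply: idealMl; apply/I_gen => J _; apply; exists (psub q i i.+2).
Qed.

(** I is spanned by the paths that it contains. *)
Lemma I_coefP f : I f <-> forall q, coef f q != 0 -> I (pvec k q).
Proof.
split=> [If q fq|If]; first exact/has_relP/(I_has_rel If).
apply: (@path_alg_supp_ind _ _ I f); [exact: ideal0|exact: idealD|].
by move=> q /If; apply: idealZ.
Qed.

Lemma I_psub q i j : (i <= j <= plength q)%N ->
  I (pvec k (psub q i j)) -> I (pvec k q).
Proof. by move=> ijq /has_relP h; apply/has_relP; apply: has_rel_psub h. Qed.

Lemma psub_arrow a0 q l : (l < plength q)%N ->
  psub q l l.+1 = parrow (nth a0 (parrows q) l).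
Proof.
move=> lq.
have ea : parrows (psub q l l.+1) = [:: nth a0 (parrows q) l].
  by rewrite parrows_psub subSnn (drop_nth a0) //= take0.
apply: qpath_inj => //.
have := valP (psub q l l.+1); rewrite -/(psrc _) -/(parrows _) ea /= andbT.
by move/eqP.
Qed.

Lemma pvec_arrow q a :
  ~ I (pvec k q * avec k a) -> exists r, [/\ ~ I (pvec k r), plength r = (plength q).+1,
    pvec k q * avec k a = pvec k r, q = psub r 0 (plength q)
    & parrow a = psub r (plength q) (plength q).+1].
Proof.
have -> : pvec k q * avec k a = Defs.pprod k q (parrow a) by exact: path_mulU.
rewrite /Defs.pprod; case e: Defs.pcomp => [r|] /= h; last by case: h; apply: ideal0.
have [e1 e2] := pcomp_split e.
have er : plength r = (plength q).+1.
  by have [_ _ _ ea] := pcomp_some e; rewrite /plength ea size_cat addn1.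
by exists r; split=> //; rewrite -er.
Qed.

Lemma pvec_larrow q a :
  ~ I (avec k a * pvec k q) -> exists r, [/\ ~ I (pvec k r), plength r = (plength q).+1
    & q = psub r 1 (plength r)].
Proof.
have -> : avec k a * pvec k q = Defs.pprod k (parrow a) q by exact: path_mulU.
rewrite /Defs.pprod; case e: Defs.pcomp => [r|] /= h; last by case: h; apply: ideal0.
have [e1 e2] := pcomp_split e.
have er : plength r = (plength q).+1.
  by have [_ _ _ ea] := pcomp_some e; rewrite /plength ea size_cat add1n.
by exists r.
Qed.

Section FiniteDimensional.
Variables (A : falgType k) (phi : {rmorphism path_alg k Q -> A}).
Hypotheses (phiZ : scalable phi) (phi_surj : forall y, exists x, phi x = y).
Hypothesis phi0 : forall x, phi x = 0 <-> I x.

(** The prefixes of a nonzero path are nonzero paths of different lengths, so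
    they are linearly independent in A. *)
Lemma plength_bound q : ~ I (pvec k q) -> (plength q < \dim {:A})%N.
Proof.
move=> nI; pose m := (plength q).+1.
pose pre (l : 'I_m) := psub q 0 l.
pose X := [tuple phi (pvec k (pre l)) | l < m].
suff /eqP frX : free X.
  by rewrite -[X in (X <= _)%N](size_tuple X) -frX; apply/dimvS/subvf.
apply/freeP => c c0 l; apply: contrapT => /eqP cl.
suff : I (\sum_(l < m) c l *: pvec k (pre l)).
  move=> /I_coefP /(_ (pre l)); rewrite coef_sum (bigD1 l) //= big1 => [|l' ne].
    rewrite coefZ coef_pvec eqxx mulr1 addr0 => /(_ cl) h; apply: nI.
    by apply: I_psub h; rewrite /= -ltnS.
  rewrite coefZ coef_pvec; case: eqP => [E|]; last by rewrite mulr0.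
  case/eqP: ne; apply: val_inj; have := congr1 (@plength Q) E.
  by rewrite !plength_psub ?subn0 //= -ltnS.
apply/phi0; rewrite rmorph_sum -[RHS]c0; apply: eq_bigr => l' _.
by rewrite phiZ -tnth_nth tnth_mktuple.
Qed.

(** A nonzero path that is not maximal can be lengthened by an arrow, and the
    length of nonzero paths is bounded. *)
Lemma maximal_path_exists q : ~ I (pvec k q) ->
  exists m i j, [/\ maximal_path I m, (i <= j <= plength m)%N & q = psub m i j].
Proof.
have [e] := ubnP (\dim {:A} - plength q)%N; elim: e q => // e IH q le nI.
have lq := plength_bound nI.
case: (pselect (maximal_path I q)) => [mq|nmq].
  by exists q, 0%N, (plength q); rewrite psub_full leqnn.
have [a [na|na]] : exists a, ~ I (pvec k q * avec k a) \/ ~ I (avec k a * pvec k q).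
- apply: contrapT => no; apply: nmq; split=> // a.
  by split; apply: contrapT => h; apply: no; exists a; [left|right].
- have [r [nr er _ qr _]] := pvec_arrow na.
  have lr := plength_bound nr.
  have [|m [i [j [mm ijm rm]]]] := IH r _ nr; first by lia.
  have lij : plength r = (j - i)%N by rewrite rm plength_psub.
  exists m, (i + 0)%N, (i + plength q)%N; split=> //; first by lia.
  by rewrite -(@psub_psub _ m i j) -?rm //; lia.
- have [r [nr er qr]] := pvec_larrow na.
  have lr := plength_bound nr.
  have [|m [i [j [mm ijm rm]]]] := IH r _ nr; first by lia.
  have lij : plength r = (j - i)%N by rewrite rm plength_psub.
  exists m, (i + 1)%N, (i + plength r)%N; split=> //; first by lia.
  by rewrite -(@psub_psub _ m i j) -?rm //; lia.
Qed.


End FiniteDimensional.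

Section OneMaximalPath.
Variable p : qpath Q.
Hypothesis p_max : maximal_path I p.
Hypothesis p_uniq : forall q, maximal_path I q -> q = p.
Hypothesis nrel_r :
  forall a b b', path_notin I a b -> path_notin I a b' -> b = b'.

Lemma pvec_arrows2 a b r l : (l.+2 <= plength r)%N ->
  psub r l l.+1 = parrow a -> psub r l.+1 l.+2 = parrow b ->
  avec k a * avec k b = pvec k (psub r l l.+2).
Proof.
by move=> lr ea eb; rewrite /avec -ea -eb -pvec_psub //; lia.
Qed.

Lemma psub_notin r l a b : (l.+2 <= plength r)%N -> ~ I (pvec k (psub r l l.+2)) ->
  psub r l l.+1 = parrow a -> psub r l.+1 l.+2 = parrow b -> path_notin I a b.
Proof.
move=> lr nI ea eb; split; last by rewrite (pvec_arrows2 lr ea eb).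
rewrite /composable; have -> : atgt a = ptgt (parrow a) by [].
by rewrite -ea ptgt_psub // -(psrc_psub r l.+1 l.+2) eb.
Qed.

(** If an arrow occurred twice in [p], the arrows following its two occurrences
    would agree for as long as both exist, since the nonzero continuation of an
    arrow is unique.  The last arrow of [p] would then have a nonzero
    continuation, and [p] would not be maximal. *)
Lemma maximal_path_uniq : uniq (parrows p).
Proof.
case: (posnP (plength p)) => [/size0nil -> //|].
case e: (parrows p) => [|a0 s]; first by rewrite /plength e.
rewrite -e => _; apply/(uniqPn a0) => -[i [j [ij jp eij]]].
pose ar := nth a0 (parrows p); pose n := plength p.
have arE l : (l < n)%N -> psub p l l.+1 = parrow (ar l) by exact: psub_arrow.
have step l : (l.+1 < n)%N -> path_notin I (ar l) (ar l.+1).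
  move=> ln; apply: (@psub_notin p l); rewrite ?arE //; last by lia.
  by move=> /I_psub h; case: p_max => + _; apply; apply: h; lia.
have shift t : (j + t < n)%N -> ar (i + t)%N = ar (j + t)%N.
  elim: t => [|t IH] h; first by rewrite !addn0.
  have := step (j + t)%N; rewrite -IH -?addnS; last by lia.
  move=> /(_ ltac:(lia)) h1; apply: nrel_r h1.
  by rewrite addnS; apply: step; lia.
(* the position that is as far from [i] as the last one is from [j] *)
pose f := (n.-1 - (j - i))%N.
have jn : (j < n)%N by [].
have fE : ar n.-1 = ar f.
  have := shift (n.-1 - j)%N.
  have -> : (i + (n.-1 - j) = f)%N by rewrite /f; lia.
  have -> : (j + (n.-1 - j) = n.-1)%N by lia.
  by move=> -> //; lia.
have [comp nI] := step f ltac:(rewrite /f; lia).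
rewrite -fE in comp nI.
have [_ /(_ (ar f.+1)) [Ipb _]] := p_max.
have tp : ptgt p = psrc (parrow (ar f.+1)).
  rewrite -{1}(psub_full p) ptgt_psub // -(@ptgt_psub _ p n.-1); last exact: leq_pred.
  have -> : plength p = n.-1.+1 by rewrite -/n; lia.
  by rewrite arE //; lia.
have epb : Defs.pcomp p (parrow (ar f.+1)) <> None by rewrite (pcompE tp).
case er: (Defs.pcomp p (parrow (ar f.+1))) epb => [r|] // _.
have [e1 e2] := pcomp_split er.
have lr : plength r = n.+1.
  by have [_ _ _ ea] := pcomp_some er; rewrite /plength ea size_cat addn1.
have {}Ipb : I (pvec k r).
  by move: Ipb; rewrite /avec -/(path_mul _ _) [X in I X]path_mulU /Defs.pprod er.
have subr x y : (x <= y <= n)%N -> psub r x y = psub p x y.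
  by move=> xy; rewrite e1 psub_psub ?subn0.
have {Ipb}/has_relP [l []] := Ipb; rewrite lr => ln Sl.
case: (ltnP l.+1 n) => ln'.
  rewrite subr in Sl; last by lia.
  by case: p_max => + _; apply; apply/has_relP; exists l; split.
apply: nI; rewrite (@pvec_arrows2 _ _ r l); first 1 last.
- by rewrite lr.
- by rewrite subr; [rewrite arE; [congr parrow; congr ar|]|]; lia.
- by rewrite e2 lr; congr psub; rewrite -/n; lia.
have e0 : psub (psub r l l.+2) 0 2 = psub r l l.+2.
  by rewrite psub_psub ?addn0 ?addn2 //; lia.
apply/has_relP; exists 0%N; rewrite e0; split=> //.
by rewrite plength_psub; lia.
Qed.

Lemma psub_inj i j (r s : nat) : (i < j <= plength p)%N -> (r <= s <= plength p)%N ->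
  psub p r s = psub p i j -> r = i /\ s = j.
Proof.
move=> ij rs e.
have := congr1 (@plength Q) e; rewrite !plength_psub //; last by lia.
move=> el; have lt_rs : (r < s)%N by lia.
suff ri : r = i by split=> //; lia.
case ea: (parrows p) => [|a0 t]; first by move: ij; rewrite /plength ea /=; lia.
have := congr1 (fun q => nth a0 (parrows q) 0) e.
rewrite !parrows_psub !nth_take ?nth_drop ?addn0; try lia.
move/eqP; rewrite nth_uniq ?maximal_path_uniq -/(plength p); try lia.
Qed.

Lemma psub0_eq i (r s : nat) : (i <= plength p)%N -> (r <= s <= plength p)%N ->
  (psub p r s == ptriv (psrc (psub p i i))) =
  (r == s) && (psrc (psub p r r) == psrc (psub p i i)).
Proof.
move=> ip rs; apply/eqP/andP => [e|[/eqP <- /eqP e]].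
  have := congr1 (@plength Q) e; rewrite plength_psub // => el.
  have {el} el : r = s by rewrite /plength /= in el; lia.
  by rewrite -el in e *; rewrite e.
by apply: qpath_inj; rewrite ?parrows_psub ?subnn ?take0 // -e.
Qed.

Section Representation.
Variables (A : falgType k) (phi : {rmorphism path_alg k Q -> A}).
Hypotheses (phiZ : scalable phi) (phi_surj : forall y, exists x, phi x = y).
Hypothesis phi0 : forall x, phi x = 0 <-> I x.
Variables (n : nat) (alpha : 'S_n.+1).
Hypothesis p_perm : associated_perm p alpha.

(** The entries below the diagonal have to be set to zero explicitly: there
    [psub p i j] is a trivial path. *)
Definition path_mx f : 'M[k]_n.+1 :=
  \matrix_(i, j) if (i <= j)%N then coef f (psub p i j) else 0.

Let p_len : plength p = n. Proof. by case: p_perm. Qed.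

Lemma path_mxD f g : path_mx (f + g) = path_mx f + path_mx g.
Proof.
by apply/matrixP => i j; rewrite !mxE coefD; case: ifP; rewrite ?addr0.
Qed.

Lemma path_mxZ c f : path_mx (c *: f) = c *: path_mx f.
Proof.
by apply/matrixP => i j; rewrite !mxE coefZ; case: ifP; rewrite ?mulr0.
Qed.

Lemma path_mx1 : path_mx 1 = 1.
Proof.
apply/matrixP => i j; rewrite !mxE coef1.
case: leqP => ij; last by case: eqP => // e; rewrite e ltnn in ij.
rewrite plength_psub ?p_len; last by have := ltn_ord j; lia.
rewrite subn_eq0.
by rewrite -val_eqE eqn_leq /= ij.
Qed.

Lemma path_mxM f g : path_mx (f * g) = path_mx f * path_mx g.
Proof.
apply/matrixP => i j; rewrite !mxE; case: leqP => ij; last first.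
  rewrite big1 // => l _; rewrite !mxE; case: leqP => il; last by rewrite mul0r.
  by case: leqP => lj; rewrite ?mulr0 //; move: (leq_trans il lj); rewrite leqNgt ij.
have jn : (j <= n)%N by rewrite -ltnS.
rewrite coef_mul plength_psub ?p_len ?ij //.
pose F l := coef f (psub p i l) * coef g (psub p l j).
have -> : \sum_(l < n.+1) path_mx f i l * path_mx g l j =
    \sum_(0 <= l < n.+1 | (i <= l <= j)%N) F l.
  rewrite big_mkord [LHS](bigID (fun l : 'I_n.+1 => (i <= l <= j)%N)) /=.
  rewrite [X in _ + X]big1 ?addr0 => [|l]; last first.
    by rewrite !mxE; case: leqP => //= il; case: leqP; rewrite ?mulr0 ?mul0r.
  by apply: eq_bigr => l /andP[il lj]; rewrite !mxE il lj.
rewrite (big_cat_nat (n := i)) /=; [|lia|lia].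
rewrite [X in _ = X + _]big_nat_cond [X in _ = X + _]big_pred0 ?add0r => [|l]; last first.
  by apply/negbTE/negP => /andP[/andP[_ h1] /andP[h2 _]]; rewrite leqNgt h1 in h2.
rewrite (big_cat_nat (n := j.+1)) /=; [|lia|lia].
rewrite [X in _ = _ + X]big_nat_cond [X in _ = _ + X]big_pred0 ?addr0 => [|l]; last first.
  by apply/negbTE/negP => /andP[/andP[h1 _] /andP[_ h2]]; rewrite leqNgt h1 in h2.
rewrite -[X in \sum_(X <= _ < _ | _) _](add0n i) big_addn [RHS]big_mkcond /=.
rewrite (_ : (j.+1 - i = (j - i).+1)%N); last by lia.
rewrite [RHS]big_mkord; apply: eq_bigr => l _; have lj := ltn_ord l.
rewrite !psub_psub; try lia.
have -> : (i <= l + i <= j)%N by lia.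
by rewrite /F addn0 subnKC // (addnC i).
Qed.


(** This is where the uniqueness of the maximal path enters: all nonzero paths
    are segments of [p]. *)
Lemma path_mx_ker f : path_mx f = 0 <-> I f.
Proof.
split=> [f0|/I_coefP If].
  apply/I_coefP => q fq; apply: contrapT => nI.
  have [m [i [j [/p_uniq -> ijp qE]]]] := maximal_path_exists phiZ phi0 nI.
  have [ij jn] : (i <= j)%N /\ (j < n.+1)%N by rewrite ltnS -p_len; lia.
  have := congr1 (fun X : 'M_n.+1 => X (inord i) (inord j)) f0.
  by rewrite !mxE !inordK //; [rewrite ij -qE => /eqP; apply/negP|lia].
apply/matrixP => i j; rewrite !mxE; case: leqP => // ij; apply: contrapT => /eqP /If.
have [nIp _] := p_max; move/I_psub => h; apply: nIp; apply: h.
by rewrite p_len ij -ltnS /=.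
Qed.

Definition rep_mx (a : A) : 'M[k]_n.+1 := path_mx (sval (cid (phi_surj a))).

Lemma rep_mx_phi f : rep_mx (phi f) = path_mx f.
Proof.
rewrite /rep_mx; case: cid => f' /= e; apply/eqP; rewrite -subr_eq0; apply/eqP.
rewrite -scaleN1r -path_mxZ -path_mxD; apply/path_mx_ker/phi0.
by rewrite rmorphD phiZ e scaleN1r subrr.
Qed.

Fact rep_mx_zmod : zmod_morphism rep_mx.
Proof.
move=> x y; have [f <-] := phi_surj x; have [g <-] := phi_surj y.
by rewrite -rmorphB !rep_mx_phi -scaleN1r path_mxD path_mxZ scaleN1r.
Qed.
Fact rep_mx_monoid : monoid_morphism rep_mx.
Proof.
split=> [|x y]; first by rewrite -(rmorph1 phi) rep_mx_phi path_mx1.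
have [f <-] := phi_surj x; have [g <-] := phi_surj y.
by rewrite -rmorphM !rep_mx_phi path_mxM.
Qed.
HB.instance Definition _ := GRing.isZmodMorphism.Build A 'M[k]_n.+1 rep_mx rep_mx_zmod.
HB.instance Definition _ := GRing.isMonoidMorphism.Build A 'M[k]_n.+1 rep_mx rep_mx_monoid.

(** The two positions at which [p] can visit a vertex are exchanged by [alpha]. *)
Lemma vertex_eq (i r : 'I_n.+1) :
  (psrc (psub p r r) == psrc (psub p i i)) = (r == i) || (r == alpha i).
Proof.
have [_ /(_ i) [h1 h2]] := p_perm.
have vE (j : 'I_n.+1) : nth (psrc p) (pvertices p) j = psrc (psub p j j).
  have jn : (j <= size (parrows p))%N by rewrite -/(plength p) p_len -ltnS.
  rewrite psrc_psub (last_nth (psrc p)) map_take size_takel ?size_map //.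
  by rewrite -[psrc p :: take j _]/(take j.+1 (pvertices p)) nth_take.
case: (eqVneq r i) => [->|ri]; first by rewrite eqxx.
apply/eqP/eqP => [e|re].
  by apply/esym/h1; rewrite ?vE.
apply: contrapT => ne; move/eqP: ri; apply; rewrite re; apply: h2 => j ji.
rewrite !vE => e; have e2 := h1 j ji; rewrite !vE in e2.
by rewrite re e2 // in ne.
Qed.

Lemma rep_mx_tri_rep : inhabited (tri_rep A alpha).
Proof.
have sub_le (i j : 'I_n.+1) : (i <= j)%N -> (i <= j <= plength p)%N.
  by move=> ij; rewrite ij p_len -ltnS /=.
constructor; apply: (@TriRep _ _ _ _ [the {rmorphism A -> 'M[k]_n.+1} of rep_mx]) => /=.
- move=> c a; have [f <-] := phi_surj a.
  by rewrite -phiZ !rep_mx_phi path_mxZ.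
- move=> x y; have [f <-] := phi_surj x; have [g <-] := phi_surj y.
  rewrite !rep_mx_phi => e; apply/eqP; rewrite -subr_eq0 -rmorphB; apply/eqP/phi0.
  by apply/path_mx_ker; rewrite -scaleN1r path_mxD path_mxZ e scaleN1r subrr.
- by move=> a i j ji; rewrite mxE leqNgt ji.
- move=> a i; rewrite !mxE !leqnn; congr coef; apply: qpath_inj.
    by apply/eqP; rewrite vertex_eq eqxx orbT.
  by rewrite !parrows_psub !subnn !take0.
- move=> i j ij; exists (phi (pvec k (psub p i j))); rewrite rep_mx_phi.
  apply/matrixP => r s; rewrite !mxE; case: leqP => rs; last first.
    by case: andP => // -[/eqP ri /eqP sj]; rewrite ri sj ltnNge ltnW in rs.
  rewrite coef_pvec; congr (_%:R); congr nat_of_bool.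
  apply/eqP/andP => [e|[/eqP -> /eqP -> //]].
  have [|||e1 e2] := @psub_inj i j r s; last by split; apply/eqP/val_inj.
  + by have := sub_le i j (ltnW ij); lia.
  + exact: sub_le.
  + by [].
move=> i; exists (phi (pvec k (ptriv (psrc (psub p i i))))); rewrite rep_mx_phi.
apply/matrixP => r s; rewrite !mxE; case: leqP => rs; last first.
  by case: eqP => // e; move: rs; rewrite e ltnn.
have ii := sub_le i i (leqnn i).
rewrite coef_pvec eq_sym psub0_eq ?sub_le //; last by case/andP: ii.
by rewrite vertex_eq val_eqE.
Qed.

End Representation.
End OneMaximalPath.
End MonomialIdeal.

Lemma gentle_tri_rep (k : fieldType) (A : falgType k) n (alpha : 'S_n.+1) :
  gentle_one_maximal_path A alpha -> inhabited (tri_rep A alpha).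
Proof.
move=> [Q [I [lg [phi [phiZ phi_surj phi0]] [p [p_max p_uniq p_perm]]]]].
have [_ _ [S [S2 SI]] _ _ nrel_r _] := lg.
exact: (rep_mx_tri_rep S2 SI p_max p_uniq nrel_r phiZ phi_surj phi0 p_perm).
Qed.

(** * Matrix units of the algebra *)

Section MatrixUnits.
Variables (k : fieldType) (A : algType k) (n : nat) (alpha : 'S_n.+1).
Variable R : tri_rep A alpha.
Implicit Types (i j l r s c : 'I_n.+1) (a : A).

Fact unit_exists i j : exists a, R a = if (i < j)%N then delta_mx i j else 0.
Proof.
case: ltnP => [/(rho_arr R)//|_]; exists 0; exact: raddf0.
Qed.

(** Off the strict upper triangle [unt i j] is zero, so that sums over all [i]
    need no side condition. *)
Definition unt i j : A := projT1 (cid (unit_exists i j)).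
(** The idempotent of the vertex of [p] at position [i]; the positions [i] and
    [alpha i] give the same one. *)
Definition idem i : A := projT1 (cid (rho_idem R i)).

Lemma untE i j r s : R (unt i j) r s = [&& (i < j)%N, r == i & s == j]%:R.
Proof.
rewrite /unt; case: cid => a /= ->; case: ifP => _; by rewrite mxE.
Qed.

Lemma idemE i r s : R (idem i) r s = ((r == s) && ((r == i) || (r == alpha i)))%:R.
Proof. by rewrite /idem; case: cid => a /= ->; rewrite mxE. Qed.

Lemma rho_ext a b : (forall r s, R a r s = R b r s) -> a = b.
Proof. by move=> e; apply: (@rho_inj _ _ _ _ R); apply/matrixP. Qed.

Lemma rhoD a b r s : R (a + b) r s = R a r s + R b r s.
Proof. by rewrite rmorphD mxE. Qed.

Lemma rho0 r s : R 0 r s = 0.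
Proof. by rewrite rmorph0 mxE. Qed.

Lemma rho1 r s : R 1 r s = (r == s)%:R.
Proof. by rewrite rmorph1 mxE. Qed.

Lemma rhoM a b r s : R (a * b) r s = \sum_l R a r l * R b l s.
Proof. by rewrite rmorphM mxE. Qed.

Lemma rhoS (x : k) a r s : R (x *: a) r s = x * R a r s.
Proof. by rewrite rhoZ mxE. Qed.

Lemma rho_sum (J : finType) (P : pred J) (F : J -> A) r s :
  R (\sum_(x | P x) F x) r s = \sum_(x | P x) R (F x) r s.
Proof. by rewrite rmorph_sum summxE. Qed.

Lemma rho_unt_mul a i j r s :
  R (a * unt i j) r s = (if (i < j)%N && (s == j) then R a r i else 0).
Proof.
rewrite rhoM (bigD1 i) //= big1 => [|l /negPf li]; last first.
  by rewrite untE li andbF mulr0.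
by rewrite untE eqxx addr0 /=; case: ifP; rewrite ?mulr1 ?mulr0.
Qed.

Lemma unt_rho_mul a i j r s :
  R (unt i j * a) r s = (if (i < j)%N && (r == i) then R a j s else 0).
Proof.
rewrite rhoM (bigD1 j) //= big1 => [|l /negPf lj]; last first.
  by rewrite untE lj !andbF mul0r.
by rewrite untE eqxx addr0 andbT; case: ifP; rewrite ?mul1r ?mul0r.
Qed.

Lemma rho_idem_mul a i r s :
  R (idem i * a) r s = (if (r == i) || (r == alpha i) then R a r s else 0).
Proof.
rewrite rhoM (bigD1 r) //= big1 => [|l lr]; last first.
  by rewrite idemE eq_sym (negPf lr) mul0r.
by rewrite idemE eqxx addr0 /=; case: ifP; rewrite ?mul1r ?mul0r.
Qed.

Lemma unt_ge i j : (j <= i)%N -> unt i j = 0.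
Proof. by move=> ij; apply: rho_ext => r s; rewrite untE rho0 ltnNge ij. Qed.

Lemma unt_unt i j l : (i < j)%N -> (j < l)%N -> unt i j * unt j l = unt i l.
Proof.
move=> ij jl; apply: rho_ext => r s; rewrite unt_rho_mul ij /= !untE jl eqxx.
by rewrite (ltn_trans ij jl) /=; case: eqP.
Qed.

Lemma unt_unt0 i j j' l : j != j' -> unt i j * unt j' l = 0.
Proof.
move=> jj; apply: rho_ext => r s; rewrite unt_rho_mul untE rho0 (negPf jj) andbF.
by case: ifP.
Qed.

Lemma idem_unt i j : idem i * unt i j = unt i j.
Proof.
apply: rho_ext => r s; rewrite rho_idem_mul untE.
by case: eqP => //= _; rewrite andbF; case: ifP.
Qed.

Lemma idem_id i : idem i * idem i = idem i.
Proof.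
apply: rho_ext => r s; rewrite rho_idem_mul idemE.
by case: (r == s); case: (r == i); case: (r == alpha i).
Qed.

Hypothesis alphaK : forall i, alpha (alpha i) = i.

Lemma idem_alpha i : idem (alpha i) = idem i.
Proof. by apply: rho_ext => r s; rewrite !idemE alphaK [X in _ && X]orbC. Qed.

Lemma idem_alpha_unt i j : idem i * unt (alpha i) j = unt (alpha i) j.
Proof. by rewrite -idem_alpha idem_unt. Qed.

Lemma idem_idem i j : idem i * idem j =
  if (j == i) || (j == alpha i) then idem i else 0.
Proof.
apply: rho_ext => r s; rewrite rho_idem_mul !idemE.
have e : (j == alpha i) = (i == alpha j).
  by apply/eqP/eqP => ->; rewrite alphaK.
have [->|ri] := eqVneq r i.
  rewrite e [X in if X then idem _ else _](_ : _ = (i == j) || (i == alpha j)); last by rewrite eq_sym.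
  by case: ifP => _; rewrite ?andbF ?rho0 // idemE eqxx /= andbT.
have [->|rai] /= := eqVneq r (alpha i).
  rewrite (inj_eq perm_inj) [X in if X then idem _ else _](_ : _ = (alpha i == j) || (i == j)).
    by case: ifP => _; rewrite ?andbF ?rho0 // idemE eqxx orbT andbT.
  by rewrite orbC (eq_sym j i) (eq_sym j).
case: ifP => _; last by rewrite rho0.
by rewrite idemE (negPf ri) (negPf rai) andbF.
Qed.

Lemma mul_unt a i c : (i < c)%N ->
  a * unt i c = \sum_l R a l i *: unt l c.
Proof.
move=> ic; apply: rho_ext => r s; rewrite rho_unt_mul rho_sum ic (bigD1 r) //=.
rewrite big1 ?addr0 => [|l /negPf lr].
  rewrite rhoS untE eqxx /=; case: (s == c); rewrite ?andbF ?mulr0 //= andbT.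
  case: ltnP => rc; rewrite ?mulr1 // mulr0 rho_tri //.
  exact: leq_trans ic _.
by rewrite rhoS untE eq_sym lr andbF mulr0.
Qed.

Lemma mul_idem a c : a * idem c = R a c c *: idem c + \sum_l R a l c *: unt l c +
  (if alpha c == c then 0 else \sum_l R a l (alpha c) *: unt l (alpha c)).
Proof.
have sumE j r s : \sum_l R (R a l j *: unt l j) r s =
    if (s == j) && (r < j)%N then R a r j else 0.
  rewrite (bigD1 r) //= big1 ?addr0 => [|l /negPf lr].
    rewrite rhoS untE eqxx /= andbC.
    by case: (s == j); case: ltnP; rewrite /= ?mulr0 ?mulr1.
  by rewrite rhoS untE eq_sym lr andbF mulr0.
apply: rho_ext => r s; rewrite !rhoD rhoS rho_sum sumE idemE.
have -> : R (if alpha c == c then 0 else \sum_l R a l (alpha c) *: unt l (alpha c)) r s =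
    if [&& alpha c != c, s == alpha c & (r < alpha c)%N] then R a r (alpha c) else 0.
  by case: ifP; rewrite ?rho0 // rho_sum sumE.
rewrite rhoM (bigD1 s) //= big1 ?addr0 => [|l /negPf ls]; last first.
  by rewrite idemE ls mulr0.
rewrite idemE eqxx /=.
have [sc|sc] := eqVneq s c.
  rewrite sc mulr1 (eq_sym c); have -> : (alpha c != c) && ((alpha c == c) && (r < alpha c)%N) = false.
    by case: eqP.
  rewrite addr0; have [->|rc] := eqVneq r c; first by rewrite mulr1 ltnn addr0.
  rewrite mulr0 add0r; case: ltnP => // cr; rewrite rho_tri // ltn_neqAle cr andbT.
  by rewrite eq_sym.
have [sac|sac] := eqVneq s (alpha c); last first.
  rewrite mulr0 andbF !addr0; case: (r =P s) => [->|_]; last by rewrite mulr0.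
  by rewrite (negPf sc) (negPf sac) mulr0.
rewrite -sac sc addr0 mulr1; have [->|rs] := eqVneq r s.
  by rewrite orbT /= ltnn mulr1 addr0 sac rho_diag.
rewrite mulr0 add0r /=; case: ltnP => // sr; rewrite rho_tri // ltn_neqAle sr andbT.
by rewrite eq_sym.
Qed.

(** The positions [c <= alpha c] represent the orbits of [alpha], that is, the
    vertices of the quiver. *)
Lemma sum_orbits (V : nmodType) (Y : 'I_n.+1 -> V) :
  \sum_(c < n.+1 | (c <= alpha c)%N) (Y c + if alpha c == c then 0 else Y (alpha c)) =
  \sum_c Y c.
Proof.
rewrite big_split /= [RHS](bigID (fun c => c <= alpha c)%N) /=; congr (_ + _).
rewrite [RHS](reindex_inj (@perm_inj _ alpha)) /=.
rewrite big_mkcond [RHS]big_mkcond; apply: eq_bigr => c _; rewrite alphaK -ltnNge.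
by rewrite -val_eqE; case: (ltngtP c (alpha c)).
Qed.

Lemma sum_idem : \sum_(c < n.+1 | (c <= alpha c)%N) idem c = 1.
Proof.
apply: rho_ext => r s; rewrite rho_sum rho1.
have -> : (r == s)%:R = \sum_c (if c == r then (r == s)%:R else 0) :> k.
  by rewrite -big_mkcond big_pred1_eq.
rewrite -sum_orbits; apply: eq_bigr => c _.
rewrite idemE (eq_sym r c) (eq_sym r (alpha c)).
have [->|cr] := eqVneq c r; first by rewrite andbT; case: (alpha r == r); rewrite addr0.
rewrite add0r /=; have [e|ac] := eqVneq (alpha c) c.
  by rewrite e (negPf cr) andbF.
by case: (alpha c == r); rewrite ?andbT ?andbF.
Qed.

End MatrixUnits.

(** * Projective modules realised by columns of matrices *)

Section Columns.
Variables (k : fieldType) (A : algType k) (n : nat) (alpha : 'S_n.+1).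
Variable R : tri_rep A alpha.

Lemma scalarC (M : lmodType A) (x : k) (a : A) (m : M) :
  a *: (x%:A *: m) = x%:A *: (a *: m).
Proof. by rewrite !scalerA mulr_algl mulr_algr. Qed.

(** An ambient module in which the entries with second index [c] and boolean [b]
    form one column, on which A acts by matrix multiplication.  The submodules
    [pmod] below are the direct sums over c of A e_c tensor V_c: the boolean
    [false] marks the column [c] and [true] the column [alpha c] of the summand
    A e_c. *)
Definition colmod (r : tri_rep A alpha) (M : lmodType A) : Type :=
  {ffun 'I_n.+1 * 'I_n.+1 * bool -> M}.
HB.instance Definition _ r M :=
  GRing.Zmodule.copy (colmod r M) {ffun 'I_n.+1 * 'I_n.+1 * bool -> M}.

Section Action.
Variable M : lmodType A.
Implicit Types (F G : colmod R M) (a : A) (i c : 'I_n.+1) (b t : bool).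

Definition entry F (i c : 'I_n.+1) (b : bool) : M := F (i, c, b).

Definition col_of (f : 'I_n.+1 -> 'I_n.+1 -> bool -> M) : colmod R M :=
  [ffun x => f x.1.1 x.1.2 x.2].

Lemma entry_col f i c b : entry (col_of f) i c b = f i c b.
Proof. by rewrite /entry ffunE. Qed.

Lemma colP F G : (forall i c b, entry F i c b = entry G i c b) -> F = G.
Proof. by move=> e; apply/ffunP => -[[i c] b]; apply: e. Qed.

Lemma entryD F G i c b : entry (F + G) i c b = entry F i c b + entry G i c b.
Proof. by rewrite /entry ffunE. Qed.

Lemma entry0 i c b : entry 0 i c b = 0.
Proof. by rewrite /entry ffunE. Qed.

Lemma entry_sum (J : Type) (s : seq J) (P : pred J) (F : J -> colmod R M) i c b :
  entry (\sum_(j <- s | P j) F j) i c b = \sum_(j <- s | P j) entry (F j) i c b.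
Proof. by elim/big_ind2: _ => [|? ? ? ? <- <-|//]; rewrite ?entry0 ?entryD. Qed.

Definition col_scale a F : colmod R M :=
  col_of (fun i c b => \sum_l (R a i l)%:A *: entry F l c b).

Fact col_scaleA a a' F : col_scale a (col_scale a' F) = col_scale (a * a') F.
Proof.
apply: colP => i c t; rewrite !entry_col.
under eq_bigr => l _ do rewrite entry_col scaler_sumr.
rewrite exchange_big; apply: eq_bigr => l _ /=.
rewrite rhoM scaler_suml scaler_suml; apply: eq_bigr => s _.
by rewrite scalerA mulr_algl scalerA.
Qed.

Fact col_scale1 : left_id 1 col_scale.
Proof.
move=> F; apply: colP => i c t; rewrite entry_col (bigD1 i) //= big1 => [|l li].
  by rewrite rho1 eqxx !scale1r addr0.
by rewrite rho1 eq_sym (negPf li) !scale0r.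
Qed.

Fact col_scaleDr : right_distributive col_scale +%R.
Proof.
move=> a F G; apply: colP => i c t; rewrite entryD !entry_col -big_split.
by apply: eq_bigr => l _; rewrite entryD scalerDr.
Qed.

Fact col_scaleDl F : {morph col_scale^~ F : a a' / a + a'}.
Proof.
move=> a a'; apply: colP => i c t; rewrite entryD !entry_col -big_split.
by apply: eq_bigr => l _; rewrite rhoD !scalerDl.
Qed.
HB.instance Definition _ := GRing.Zmodule_isLmodule.Build A (colmod R M)
  col_scaleA col_scale1 col_scaleDr col_scaleDl.

Lemma entryZ a F i c b : entry (a *: F) i c b = \sum_l (R a i l)%:A *: entry F l c b.
Proof. exact: entry_col. Qed.

(** Matrix multiplication moves only the row index, so combining and rescaling
    columns is A-linear. *)
Definition reindex_col (w : 'I_n.+1 -> bool -> A)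
    (u : 'I_n.+1 -> bool -> 'I_n.+1 * bool) F : colmod R M :=
  col_of (fun i c b => w c b *: entry F i (u c b).1 (u c b).2).

Fact reindex_col_linear w u : linear (reindex_col w u).
Proof.
move=> a F G; apply: colP => i c b; rewrite entryD entryZ !entry_col entryD entryZ.
rewrite scalerDr scaler_sumr; congr (_ + _); apply: eq_bigr => l _.
by rewrite entry_col scalarC.
Qed.
HB.instance Definition _ w u := GRing.isLinear.Build A (colmod R M) (colmod R M) _
  (reindex_col w u) (reindex_col_linear w u).

End Action.

Definition pos (c : 'I_n.+1) (b : bool) := if b then alpha c else c.

(** The elements of the sum over [c] in [D] of A e_c tensor e_(t c) M.  The left ideal
    A e_c consists of two columns of an upper triangular matrix that share their
    diagonal entry, whence [pc_diag]; if [c] is isolated there is only one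
    column, whence [pc_iso]. *)
Record pcond (D : pred 'I_n.+1) (t : 'I_n.+1 -> 'I_n.+1) (M : lmodType A)
    (F : colmod R M) : Prop := PCond {
  pc_idem : forall i c b, idem R (t c) *: entry F i c b = entry F i c b;
  pc_dom : forall i c b, ~~ D c -> entry F i c b = 0;
  pc_le : forall (i c : 'I_n.+1) b, (pos c b < i)%N -> entry F i c b = 0;
  pc_iso : forall i c, alpha c = c -> entry F i c true = 0;
  pc_diag : forall c, alpha c <> c -> entry F (alpha c) c true = entry F c c false }.

Definition pc_pred D t M : {pred colmod R M} := [pred F | `[< pcond D t F >]].

Lemma entryZ_pos D t M (F : colmod R M) a c b : pcond D t F ->
  entry (a *: F) (pos c b) c b = (R a (pos c b) (pos c b))%:A *: entry F (pos c b) c b.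
Proof.
move=> [_ _ F3 _ _]; rewrite entryZ (bigD1 (pos c b)) //= big1 ?addr0 // => l lp.
case: (ltngtP l (pos c b)) => hl.
- by rewrite rho_tri // !scale0r.
- by rewrite F3 ?scaler0.
- by case/eqP: lp; apply: val_inj.
Qed.

Fact pc_submod D t M : GRing.submod_closed (@pc_pred D t M).
Proof.
split=> [|a F G /asboolP pF /asboolP [G1 G2 G3 G4 G5]]; apply/asboolP.
  by split=> *; rewrite !entry0 ?scaler0.
have [F1 F2 F3 F4 F5] := pF.
split=> [i c b|i c b h|i c b h|i c h|c h]; rewrite !entryD ?entryZ.
- rewrite scalerDr scaler_sumr G1; congr (_ + _); apply: eq_bigr => l _.
  by rewrite scalarC F1.
- by rewrite G2 // addr0 big1 // => l _; rewrite F2 ?scaler0.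
- rewrite G3 // addr0 big1 // => l _; case: (ltnP (pos c b) l) => hl.
    by rewrite F3 ?scaler0.
  by rewrite rho_tri ?scale0r ?scale0r // (leq_ltn_trans hl).
- by rewrite G4 // addr0 big1 // => l _; rewrite F4 ?scaler0.
rewrite -!entryZ G5 //; congr (_ + _).
by rewrite (entryZ_pos a c true pF) (entryZ_pos a c false pF) /= F5 // rho_diag.
Qed.
HB.instance Definition _ D t M :=
  GRing.isSubmodClosed.Build A (colmod R M) (@pc_pred D t M) (@pc_submod D t M).

Record pmod D t M := PMod { pval :> colmod R M; _ : pval \in @pc_pred D t M }.
HB.instance Definition _ D t M := [isSub for @pval D t M].
HB.instance Definition _ D t M := [Choice of @pmod D t M by <:].
HB.instance Definition _ D t M := [SubChoice_isSubLmodule of @pmod D t M by <:].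

Lemma pmodP D t M (F : pmod D t M) : pcond D t (pval F).
Proof. exact/asboolP/(valP F). Qed.

Definition pmk D t M (F : colmod R M) (h : pcond D t F) : pmod D t M :=
  PMod (introT (asboolP _) h).

Section Restrict.
Variables (D D' : pred 'I_n.+1) (t t' : 'I_n.+1 -> 'I_n.+1) (M N : lmodType A).
Variable f : {linear colmod R M -> colmod R N}.
Hypothesis fP : forall F, pcond D t F -> pcond D' t' (f F).

Definition restr (F : pmod D t M) : pmod D' t' N := pmk (fP (pmodP F)).

Fact restr_linear : linear restr.
Proof. by move=> a F G; apply: val_inj; rewrite /= linearP. Qed.
HB.instance Definition _ := GRing.isLinear.Build A (pmod D t M) (pmod D' t' N) _
  restr restr_linear.
End Restrict.

Section Evaluation.
Variables (D : pred 'I_n.+1) (t : 'I_n.+1 -> 'I_n.+1) (M N : lmodType A).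
Variable th : 'I_n.+1 -> M -> N.
Hypothesis thD : forall c x y, th c (x + y) = th c x + th c y.
Hypothesis thZ : forall c (x : k) m, th c (x%:A *: m) = x%:A *: th c m.

(** The A-linear map A e_c tensor V_c -> N that extends the k-linear map [th c]. *)
Definition evc (F : colmod R M) c : N :=
  idem R c *: th c (entry F c c false) +
  \sum_(b : bool) \sum_i unt R i (pos c b) *: th c (entry F i c b).

Definition ev (F : pmod D t M) : N := \sum_c evc (pval F) c.

Let th0 c : th c 0 = 0.
Proof. by apply: (@addrI _ (th c 0)); rewrite -thD !addr0. Qed.

Let th_sum c (J : finType) (F : J -> M) : th c (\sum_j F j) = \sum_j th c (F j).
Proof. by apply: (big_morph (th c)). Qed.

(** The diagonal entry of [F] contributes to both columns, which matches the
    three terms of [mul_idem]. *)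
Lemma evcZ a F c : pcond D t F -> evc (a *: F) c = a *: evc F c.
Proof.
move=> pF; have [F1 F2 F3 F4 F5] := pF; rewrite /evc scalerDr scaler_sumr.
have side b : \sum_i unt R i (pos c b) *: th c (entry (a *: F) i c b) =
    a *: (\sum_i unt R i (pos c b) *: th c (entry F i c b)) +
    (\sum_i R a i (pos c b) *: unt R i (pos c b)) *: th c (entry F (pos c b) c b).
  under eq_bigr => i _ do rewrite entryZ th_sum scaler_sumr.
  rewrite exchange_big (bigD1 (pos c b)) //= addrC; congr (_ + _).
    rewrite scaler_sumr [RHS](bigD1 (pos c b)) //= unt_ge // scale0r scaler0 add0r.
    apply: eq_bigr => l lp; case: (ltngtP l (pos c b)) => hl.
    - rewrite scalerA mul_unt // scaler_suml; apply: eq_bigr => i _.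
      by rewrite thZ scalarC scalerA mulr_algl.
    - by rewrite F3 // th0 !scaler0 big1 // => i _; rewrite scaler0 th0 scaler0.
    - by case/eqP: lp; apply: val_inj.
  rewrite scaler_suml; apply: eq_bigr => i _.
  by rewrite thZ scalarC scalerA mulr_algl.
rewrite !big_bool !side /= scalerA mul_idem (entryZ_pos a c false pF) /= thZ.
set y := th c (entry F c c false); set x := R a c c.
rewrite scalarC !scalerDl -[x *: idem R c]mulr_algl -scalerA -!addrA; congr (_ + _).
set z := (if _ then _ else _).
have -> : z *: y = (\sum_l R a l (alpha c) *: unt R l (alpha c)) *: th c (entry F (alpha c) c true).
  rewrite /z; case: eqP => e; first by rewrite scale0r F4 // th0 scaler0.
  by rewrite F5.
rewrite [RHS]addrA [RHS]addrC -!addrA; congr (_ + _); rewrite [LHS]addrCA.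
by congr (_ + _); exact: addrC.
Qed.

Fact ev_linear : linear ev.
Proof.
move=> a F G; rewrite /ev scaler_sumr -big_split; apply: eq_bigr => c _ /=.
rewrite -evcZ; last exact: pmodP.
rewrite /evc entryD thD scalerDr -!addrA; congr (_ + _).
rewrite addrCA; congr (_ + _); rewrite -big_split; apply: eq_bigr => b _ /=.
by rewrite -big_split; apply: eq_bigr => i _ /=; rewrite entryD thD scalerDr.
Qed.

Definition ev_lin : {linear pmod D t M -> N} :=
  HB.pack ev (GRing.isLinear.Build A (pmod D t M) N _ ev ev_linear).

End Evaluation.

Section Generators.
Variables (D : pred 'I_n.+1) (t : 'I_n.+1 -> 'I_n.+1) (M : lmodType A).

Fact gen_pcond c (m : M) : pcond D t (col_of (fun i c' b =>
  if [&& D c, c' == c, i == pos c b & ~~ (b && (alpha c == c))]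
  then idem R (t c) *: m else 0)).
Proof.
split=> [i c' b|i c' b h|i c' b h|i c' h|c' h]; rewrite !entry_col.
- case: ifP => [/and4P[_ /eqP -> _ _]|_]; last by rewrite scaler0.
  by rewrite scalerA idem_id.
- by case: ifP => // /and4P[Dc /eqP e]; rewrite e Dc in h.
- by case: ifP => // /and4P[_ /eqP e /eqP ei]; rewrite ei e ltnn in h.
- by case: ifP => // /and4P[_ /eqP e _]; rewrite -e h eqxx.
by case: (c' =P c) => [<-|]; rewrite ?andbF //= !eqxx /=; move/eqP/negPf: h => ->.
Qed.
(** The element e_c tensor e_(t c) m. *)
Definition gen c (m : M) : pmod D t M := pmk (gen_pcond c m).

Lemma genE c m i c' b : entry (pval (gen c m)) i c' b =
  if [&& D c, c' == c, i == pos c b & ~~ (b && (alpha c == c))]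
  then idem R (t c) *: m else 0.
Proof. exact: entry_col. Qed.

Lemma pmod_eq (F G : pmod D t M) :
  (forall i c b, entry (pval F) i c b = entry (pval G) i c b) -> F = G.
Proof. by move=> h; apply/val_inj/colP. Qed.

Lemma genD c m m' : gen c (m + m') = gen c m + gen c m'.
Proof.
apply: pmod_eq => i c' b; rewrite entryD !genE; case: ifP; rewrite ?addr0 //.
by rewrite scalerDr.
Qed.

Lemma genZ c (x : k) m : gen c (x%:A *: m) = x%:A *: gen c m.
Proof.
apply: pmod_eq => i c' b; rewrite entryZ (bigD1 i) //= big1 => [|l li].
  rewrite rhoS rho1 eqxx mulr1 addr0 !genE; case: ifP; rewrite ?scaler0 //.
  by rewrite scalarC.
by rewrite rhoS rho1 eq_sym (negPf li) mulr0 !scale0r.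
Qed.

Lemma gen0 c : gen c 0 = 0.
Proof. by apply: (@addrI _ (gen c 0)); rewrite -genD !addr0. Qed.

Lemma entry_unt i j (F : colmod R M) i' c b :
  entry (unt R i j *: F) i' c b = if (i < j)%N && (i' == i) then entry F j c b else 0.
Proof.
rewrite entryZ (bigD1 j) //= big1 => [|l lj]; last first.
  by rewrite untE (negPf lj) !andbF !scale0r.
by rewrite untE eqxx andbT addr0; case: ifP; rewrite ?scale1r ?scale0r ?scale1r ?scale0r.
Qed.

Lemma entry_idem i (F : colmod R M) i' c b :
  entry (idem R i *: F) i' c b =
  if (i' == i) || (i' == alpha i) then entry F i' c b else 0.
Proof.
rewrite entryZ (bigD1 i') //= big1 => [|l li]; last first.
  by rewrite idemE eq_sym (negPf li) !scale0r.
by rewrite idemE eqxx addr0 /=; case: ifP; rewrite ?scale1r ?scale0r ?scale1r ?scale0r.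
Qed.

Lemma pvalD (F G : pmod D t M) : pval (F + G) = pval F + pval G.
Proof. by []. Qed.

Lemma pvalZ a (F : pmod D t M) : pval (a *: F) = a *: pval F.
Proof. by []. Qed.

Lemma pval_sum (J : Type) (s : seq J) (P : pred J) (F : J -> pmod D t M) :
  pval (\sum_(j <- s | P j) F j) = \sum_(j <- s | P j) pval (F j).
Proof. exact: (big_morph (@pval D t M) (id1 := 0)). Qed.

Lemma entry_evc_gen (F : pmod D t M) c' i c b :
  entry (pval (evc gen (pval F) c')) i c b = if c' == c then entry (pval F) i c b else 0.
Proof.
have [F1 F2 F3 F4 F5] := pmodP F.
rewrite /evc pvalD entryD pvalZ entry_idem genE pval_sum entry_sum.
have -> : \sum_b' entry (pval (\sum_i' unt R i' (pos c' b') *: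
      gen c' (entry (pval F) i' c' b'))) i c b =
    \sum_b' if (i < pos c' b')%N then
      entry (pval (gen c' (entry (pval F) i c' b'))) (pos c' b') c b else 0.
  apply: eq_bigr => b' _; rewrite pval_sum entry_sum (bigD1 i) // big1 => [|i' /andP[_ ii]].
    by rewrite pvalZ entry_unt eqxx andbT [LHS]addr0.
  by rewrite pvalZ entry_unt eq_sym (negPf ii) andbF.
rewrite (eq_sym c c'); have [->|ne] := eqVneq c' c; last first.
  rewrite /= andbF if_same add0r big1 // => b' _.
  by rewrite genE (eq_sym c) (negPf ne) /= andbF if_same.
have [Dc|nDc] := boolP (D c); last first.
  rewrite !F2 //= if_same add0r big1 // => b' _.
  by rewrite genE (negPf nDc) if_same.
rewrite /= big_bool /= !genE Dc eqxx /=.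
have [ac|ac] := eqVneq (alpha c) c.
  rewrite ac; case: b => /=; first by rewrite !andbF !if_same !addr0 F4.
  rewrite !andbT eqxx orbb (F4 _ _ ac) scaler0 if_same add0r !F1.
  have [->|ic] := eqVneq i c; first by rewrite ltnn !addr0.
  case: ltnP => h; first by rewrite !add0r.
  by rewrite F3 ?addr0 //= ltn_neqAle h andbT eq_sym.
rewrite !andbF !andbT !F1.
case: b => /=.
  rewrite eqxx [c == _]eq_sym (negPf ac) if_same addr0.
  have [->|ic] := eqVneq i (alpha c).
    by rewrite orbT ltnn addr0 F5 //; apply/eqP.
  rewrite if_same add0r; case: ltnP => h //.
  by rewrite F3 //= ltn_neqAle h andbT eq_sym.
rewrite eqxx (negPf ac) if_same add0r.
have [->|ic] := eqVneq i c; first by rewrite ltnn addr0.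
rewrite if_same add0r; case: ltnP => h //.
by rewrite F3 //= ltn_neqAle h andbT eq_sym.
Qed.

Lemma pmod_gen (F : pmod D t M) : F = ev gen F.
Proof.
apply: pmod_eq => i c b; rewrite /ev pval_sum entry_sum (bigD1 c) // big1 => [|c' /andP[_ ne]].
  by rewrite entry_evc_gen eqxx [RHS]addr0.
by rewrite entry_evc_gen (negPf ne).
Qed.

(** The generators determine a linear map, by the explicit formula [ev]. *)
Lemma linear_gen (N : lmodType A) (f : {linear pmod D t M -> N}) F :
  f F = ev (fun c m => f (gen c m)) F.
Proof.
rewrite {1}(pmod_gen F) /ev linear_sum; apply: eq_bigr => c _.
rewrite /evc linearD linearZ linear_sum /=; congr (_ + _); apply: eq_bigr => b _.
by rewrite linear_sum; apply: eq_bigr => i _; rewrite linearZ.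
Qed.

Lemma ev_gen (N : lmodType A) (th : 'I_n.+1 -> M -> N) c m :
  (forall c, th c 0 = 0) -> D c -> ev th (gen c m) = idem R c *: th c (idem R (t c) *: m).
Proof.
move=> th0 Dc; rewrite /ev (bigD1 c) // big1 => [|c' /andP[_ ne]].
  rewrite [LHS]addr0 /evc genE Dc !eqxx [X in _ + X]big1 ?addr0 // => b _.
  rewrite big1 // => i _; rewrite genE Dc eqxx.
  have [->|_] /= := eqVneq i (pos c b); first by rewrite unt_ge ?scale0r.
  by rewrite th0 scaler0.
rewrite /evc genE (negPf ne) /= andbF th0 scaler0 add0r big1 // => b _.
by rewrite big1 // => i _; rewrite genE (negPf ne) /= andbF th0 scaler0.
Qed.

(** A map out of A e_c tensor V_c is a k-linear map out of V_c, and k-linear maps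
    lift along surjections. *)
Lemma projective_pmod : projective (pmod D t M).
Proof.
move=> M' N g f gsurj; have [s [gs sD sZ]] := scalar_section gsurj.
pose th c m := s (f (gen c m)).
have thD c x y : th c (x + y) = th c x + th c y by rewrite /th genD raddfD sD.
have thZ c (x : k) m : th c (x%:A *: m) = x%:A *: th c m by rewrite /th genZ linearZ sZ.
exists (ev_lin D t thD thZ) => F /=.
rewrite linear_gen /ev linear_sum; apply: eq_bigr => c _.
rewrite /evc linearD linearZ linear_sum /= gs; congr (_ + _); apply: eq_bigr => b _.
by rewrite linear_sum; apply: eq_bigr => i _; rewrite linearZ /= gs.
Qed.

End Generators.
End Columns.

(** * The Koszul resolution *)

Section Koszul.
Variables (k : fieldType) (A : algType k) (n : nat) (alpha : 'S_n.+1).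
Variable R : tri_rep A alpha.
Hypothesis alphaK : quasi_diagram alpha.
Variable g : 'I_n.+1 -> nat.
Hypothesis gP : g_spec alpha g.
Implicit Types (i j l c : 'I_n.+1) (b : bool) (m : nat).

Local Notation z := (zeta n).
Definition zpred j : 'I_n.+1 := (z^-1)%g j.

Lemma zeta_zpred j : z (zpred j) = j. Proof. exact: permKV. Qed.
Lemma zpred_zeta j : zpred (z j) = j. Proof. exact: permK. Qed.

Lemma val_zeta c : c != ord_max -> z c = c.+1 :> nat.
Proof.
move=> ne; rewrite permE /= modn_small // ltnS ltn_neqAle -ltnS ltn_ord andbT.
by move: ne; rewrite -val_eqE.
Qed.

Lemma zeta_max : z ord_max = ord0.
Proof. by apply: val_inj; rewrite permE /= modnn. Qed.

Lemma zpred0 : zpred ord0 = ord_max.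
Proof. by rewrite -zeta_max zpred_zeta. Qed.

Lemma zpred_max j : (zpred j == ord_max) = (j == ord0).
Proof. by rewrite -zeta_max -(inj_eq (@perm_inj _ z)) zeta_zpred. Qed.

Lemma val_zpred j : j != ord0 -> (zpred j).+1 = j :> nat.
Proof. by move=> ne; rewrite -val_zeta ?zeta_zpred // zpred_max. Qed.

(** The starting positions of the chains of [m] arrows with zero consecutive
    products; for [m = 0] these are the vertices of the quiver, each represented
    by its first position. *)
Definition kdom m : pred 'I_n.+1 := fun c =>
  if m is m'.+1 then (c != ord_max) && (m' < g c)%N else (c <= alpha c)%N.

(** The end of the chain of length [m] that starts at [c], up to [alpha] when
    [m = 0]. *)
Definition ktgt m c := iter m (zeta_alpha alpha) (alpha c).

(** The first step of a chain: after the arrow starting at [c] the next one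
    starts at [alpha (z c)]. *)
Lemma g_step c : c != ord_max -> g c =
  if (alpha (z c) == ord_max) || (alpha (z c) == z c) then 1%N else (g (alpha (z c))).+1.
Proof.
move=> cm; have [_ gs] := gP; have [g0 gc gmin] := gs c cm.
case: ifP => [h|/norP[h1 h2]].
  apply/eqP; rewrite eqn_leq g0 andbT; apply: gmin => //=.
  rewrite /alpha_zeta /isolated /=; case/orP: h => /eqP h; [by left|right].
  by rewrite alphaK h.
have [g0' gc' gmin'] := gs _ h1.
have le1 : (g c <= (g (alpha (z c))).+1)%N by apply: gmin => //; rewrite iterSr.
apply/eqP; rewrite eqn_leq le1 /= {le1}.
case E: (g c) g0 gc => [//|[|m]] _ gc.
  exfalso; move/eqP: h1; move/eqP: h2; case: gc => [e _ []|/eqP e []] //.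
  by have : alpha (alpha (z c)) = alpha (z c) := e; rewrite alphaK => <-.
by rewrite ltnS; apply: gmin' => //; rewrite iterSr in gc.
Qed.

Lemma kdom1 c : kdom 1 c = (c != ord_max).
Proof.
rewrite /kdom; case: eqVneq => //= cm; have [_ /(_ c cm) []] := gP; by move=> ->.
Qed.

Lemma kdomS m c : kdom m.+2 c =
  [&& c != ord_max, alpha (z c) != z c & kdom m.+1 (alpha (z c))].
Proof.
rewrite /kdom; have [//|cm /=] := eqVneq c ord_max; rewrite g_step //.
have [//|h1 /=] := eqVneq (alpha (z c)) ord_max; first by rewrite andbF.
by case: eqVneq.
Qed.

Lemma kdom_max m : kdom m.+1 ord_max = false.
Proof. by rewrite /kdom eqxx. Qed.

Lemma kdom_pred m c : kdom m.+2 c -> kdom m.+1 c.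
Proof. by case/andP => cm h; rewrite /kdom cm /= ltnW. Qed.

Lemma ktgtS m c : ktgt m.+1 c = z (alpha (ktgt m c)).
Proof. by []. Qed.

Lemma ktgtSr m c : ktgt m.+1 c = ktgt m (alpha (z c)).
Proof. by rewrite /ktgt iterSr /= /zeta_alpha /= !alphaK. Qed.

Lemma ktgt1 c : ktgt 1 c = z c.
Proof. by rewrite ktgtSr /ktgt /= alphaK. Qed.

Lemma ktgt_zpred m c : ktgt m.+1 (zpred (alpha c)) = ktgt m c.
Proof. by rewrite ktgtSr zeta_zpred alphaK. Qed.

Lemma ktgt_nonisolated m c : kdom m.+2 c -> alpha (ktgt m.+1 c) != ktgt m.+1 c.
Proof.
elim: m c => [|m IH] c; rewrite kdomS => /and3P[_ h1 h2]; first by rewrite ktgt1.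
by rewrite ktgtSr IH.
Qed.

(** The arrow of [p] leaving the position [j], and zero for the last position. *)
Definition arr j : A := unt R j (z j).

Lemma arr_max : arr ord_max = 0.
Proof. by rewrite /arr zeta_max unt_ge. Qed.

Lemma idem_arr j : idem R j * arr j = arr j. Proof. exact: idem_unt. Qed.
Lemma idem_arr_alpha j : idem R j * arr (alpha j) = arr (alpha j).
Proof. exact: idem_alpha_unt. Qed.

(** Two arrows that follow each other in the quiver but not along [p]. *)
Lemma arr_arr j : alpha (z j) != z j -> arr j * arr (alpha (z j)) = 0.
Proof. by move=> h; apply: unt_unt0; rewrite eq_sym. Qed.

Lemma unt_split j (l : 'I_n.+1) : (j < l)%N ->
  unt R j l = if l == z j then arr j else arr j * unt R (z j) l.
Proof.
move=> jl; have jm : j != ord_max.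
  by apply/eqP => e; move: jl; rewrite e ltnNge /= -ltnS ltn_ord.
case: eqP => [-> //|/eqP ne]; rewrite unt_unt //; rewrite val_zeta //.
by move: ne; rewrite -val_eqE /= val_zeta // ltn_neqAle jl andbT eq_sym.
Qed.

Section Complex.
Variable M : lmodType A.
Implicit Types (F : colmod R M).

(** The differential from degree [m.+2] to [m.+1].  The first summand multiplies
    the coefficient in M by the last arrow of the chain.  The second one moves the
    first arrow of the chain to the left factor: the column [c'] for c' = zpred
    (alpha c) becomes the column [alpha c] of the summand indexed by [c], because
    the chain from [c'] continues with the one from [c]. *)
Definition kd m : colmod R M -> colmod R M :=
  reindex_col (R:=R) (M:=M) (fun c b => (-1) ^+ m * arr (alpha (ktgt m.+1 c))) (fun c b => (c, b))
  \+ reindex_col (R:=R) (M:=M) (fun c b => if b then 1 else 0) (fun c b => (zpred (alpha c), false)).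
HB.instance Definition _ m := GRing.Linear.on (kd m).

Lemma kdE m F i c b : entry (kd m F) i c b =
  ((-1) ^+ m * arr (alpha (ktgt m.+1 c))) *: entry F i c b +
  if b then entry F i (zpred (alpha c)) false else 0.
Proof.
by rewrite /kd entryD !entry_col /=; case: b; rewrite ?scale1r ?scale0r.
Qed.

(** The columns that carry coordinates in degree 0. *)
Definition kguard c b := (c <= alpha c)%N && ~~ (b && (alpha c == c)).

(** In degree 0 the summands are indexed by vertices, so the column [j] receives
    contributions from both positions of its vertex. *)
Definition kd0 : colmod R M -> colmod R M :=
  reindex_col (R:=R) (M:=M) (fun c b => if kguard c b then 1 else 0)
    (fun c b => (zpred (pos alpha c b), false))
  \+ reindex_col (R:=R) (M:=M) (fun c b => if kguard c b then - arr (pos alpha c b) else 0)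
    (fun c b => (pos alpha c b, false))
  \+ reindex_col (R:=R) (M:=M) (fun c b => if kguard c b then - arr (alpha (pos alpha c b)) else 0)
    (fun c b => (alpha (pos alpha c b), true)).
HB.instance Definition _ := GRing.Linear.on kd0.

Definition kcol F i j := entry F i (zpred j) false - arr j *: entry F i j false -
  arr (alpha j) *: entry F i (alpha j) true.

Lemma kd0E F i c b : entry (kd0 F) i c b =
  if kguard c b then kcol F i (pos alpha c b) else 0.
Proof.
rewrite /kd0 !entryD !entry_col /kcol /=; case: ifP => _.
  by rewrite scale1r !scaleNr.
by rewrite !scale0r !addr0.
Qed.

Lemma entry_zpred0 m t F i j : pcond (kdom m.+1) t F -> (j <= i)%N ->
  entry F i (zpred j) false = 0.
Proof.
move=> [_ F2 F3 _ _] ji; have [j0|j0] := eqVneq j ord0.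
  by rewrite F2 // j0 zpred0 kdom_max.
by rewrite F3 //= val_zpred.
Qed.

Lemma kd_pcond m F : pcond (kdom m.+2) (ktgt m.+2) F ->
  pcond (kdom m.+1) (ktgt m.+1) (kd m F).
Proof.
move=> pF; have [F1 F2 F3 F4 F5] := pF; split=> [i c b|i c b h|i c b h|i c h|c h]; rewrite !kdE.
- rewrite scalerDr scalerA mulrA (commr_sign _ m) -mulrA idem_arr_alpha; congr (_ + _).
  case: b; last by rewrite scaler0.
  by rewrite -{2}(F1 i (zpred (alpha c))) ktgt_zpred.
- rewrite F2; last by apply: contra h; exact: kdom_pred.
  rewrite scaler0 add0r; case: b => //; apply: F2; apply: contra h.
  by rewrite kdomS zeta_zpred alphaK => /and3P[].
- by rewrite F3 // scaler0 add0r; case: b h => //= h; rewrite (entry_zpred0 pF) // ltnW.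
- rewrite F4 // scaler0 add0r; apply: F2.
  by rewrite kdomS zeta_zpred alphaK h eqxx /= andbF.
by rewrite F5 // addr0 (entry_zpred0 pF) ?addr0.
Qed.

Lemma kd0_pcond F : pcond (kdom 1) (ktgt 1) F -> pcond (kdom 0) (ktgt 0) (kd0 F).
Proof.
move=> pF; have [F1 F2 F3 F4 F5] := pF; split=> [i c b|i c b h|i c b h|i c h|c h]; rewrite !kd0E.
- case: ifP => _; last by rewrite scaler0.
  have -> : idem R (ktgt 0 c) = idem R (pos alpha c b).
    by rewrite /ktgt /=; case: b; rewrite //= idem_alpha.
  rewrite /kcol !scalerBr !scalerA idem_arr idem_arr_alpha; congr (_ - _ - _).
  by rewrite -{2}(F1 i (zpred _)) ktgt1 zeta_zpred ?F1 // -{1}(zeta_zpred (pos alpha c b)) -ktgt1 F1.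
- by rewrite /kguard -[(c <= _)%N]/(kdom 0 c) (negPf h).
- rewrite /kcol; set j := pos alpha c b in h *.
  have e : entry F i (alpha j) true = 0 by apply: F3; rewrite /= alphaK.
  by rewrite (entry_zpred0 pF (ltnW h)) e (F3 i j false h) !scaler0 !subr0 if_same.
- by rewrite /kguard h eqxx andbF.
rewrite /kguard /=; have -> : alpha c == c = false by apply/eqP.
case: ifP => // _.
have e : entry F c (alpha c) true = entry F (alpha c) (alpha c) false.
  by rewrite -F5 ?alphaK //; exact/nesym.
rewrite /kcol (entry_zpred0 pF (leqnn c)) (entry_zpred0 pF (leqnn (alpha c))) alphaK.
by rewrite (F5 _ h) e !sub0r addrC.
Qed.


Definition kmod m : lmodType A := pmod R (kdom m) (ktgt m) M.

Definition kdel m : {linear kmod m.+1 -> kmod m} :=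
  match m return {linear kmod m.+1 -> kmod m} with
  | 0 => restr kd0_pcond
  | m'.+1 => restr (@kd_pcond m')
  end.

(** The multiplication map, x tensor m |-> x m. *)
Definition kaug : {linear kmod 0 -> M} :=
  ev_lin R (kdom 0) (ktgt 0) (th := fun _ x => x)
    (fun _ _ _ => erefl) (fun _ _ _ => erefl).

(** The column [j] of an element of degree 0, whichever of the two positions of
    its vertex represents it. *)
Definition col0 F i j :=
  if (j <= alpha j)%N then entry F i j false else entry F i (alpha j) true.

Lemma kaugE (F : kmod 0) : kaug F =
  \sum_(c < n.+1 | (c <= alpha c)%N) idem R c *: entry (pval F) c c false +
  \sum_j \sum_i unt R i j *: col0 (pval F) i j.
Proof.
have [F1 F2 F3 F4 F5] := pmodP F.
rewrite -(sum_orbits alphaK) -big_split /= /ev [LHS](bigID (fun c => c <= alpha c)%N) /=.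
rewrite [X in _ + X]big1 ?addr0 => [|c nc]; last first.
  rewrite /evc F2 // scaler0 add0r big1 // => b _; rewrite big1 // => i _.
  by rewrite F2 // scaler0.
apply: eq_bigr => c cc; rewrite /evc big_bool /=; congr (_ + _).
rewrite addrC; congr (_ + _); first by apply: eq_bigr => i _; rewrite /col0 cc.
case: eqP => [e|ne]; first by rewrite big1 // => i _; rewrite F4 // scaler0.
apply: eq_bigr => i _; rewrite /col0 alphaK leqNgt ltn_neqAle cc andbT.
by rewrite val_eqE [c == _]eq_sym; move/eqP/negPf: ne => ->.
Qed.

Lemma kaug_surj : surjective kaug.
Proof.
move=> x; exists (\sum_(c < n.+1 | (c <= alpha c)%N) gen R (kdom 0) (ktgt 0) c x).
rewrite linear_sum /=; under eq_bigr => c cc.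
  rewrite ev_gen // scalerA (_ : idem R (ktgt 0 c) = idem R c) ?idem_id; last exact: idem_alpha.
  over.
by rewrite -scaler_suml sum_idem // scale1r.
Qed.

Lemma col0_kd0 F i j : col0 (kd0 F) i j = kcol F i j.
Proof.
rewrite /col0 !kd0E /kguard /= alphaK andbT; case: leqP => // h.
rewrite ltnW //=; by case: eqP => // e; rewrite -e ltnn in h.
Qed.

Lemma kcol_diag F c : pcond (kdom 1) (ktgt 1) F -> kcol F c c =
  - (arr c *: entry F c c false + if alpha c == c then 0
     else arr (alpha c) *: entry F (alpha c) (alpha c) false).
Proof.
move=> pF; have [F1 F2 F3 F4 F5] := pF.
rewrite /kcol (entry_zpred0 pF) // sub0r opprD; congr (_ - _).
case: eqP => e; first by rewrite F4 ?alphaK // scaler0.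
by rewrite -F5 ?alphaK //; exact/nesym.
Qed.

(** The first summand of [kcol] produces the products x a_c m for all x, the
    second one cancels those in which x is not an idempotent; what remains cancels
    against the diagonal terms [kcol_diag]. *)
Lemma kaug_kdel (F : kmod 1) : kaug (kdel 0 F) = 0.
Proof.
have pF := pmodP F; have [F1 F2 F3 F4 F5] := pF.
rewrite kaugE /=; set G := pval F in F1 F2 F3 F4 F5 pF *.
have -> : \sum_(c < n.+1 | (c <= alpha c)%N) idem R c *: entry (kd0 G) c c false =
    - \sum_c arr c *: entry G c c false.
  rewrite -(sum_orbits alphaK) -sumrN; apply: eq_bigr => c cc.
  rewrite kd0E /kguard cc /= kcol_diag // scalerN scalerDr scalerA idem_arr.
  by case: ifP; rewrite ?scaler0 // scalerA idem_arr_alpha.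
apply/eqP; rewrite addrC subr_eq0; apply/eqP.
have E j : \sum_i unt R i j *: col0 (kd0 G) i j =
    \sum_i unt R i j *: entry G i (zpred j) false -
    \sum_i (unt R i j * arr j) *: entry G i j false.
  rewrite -sumrB; apply: eq_bigr => i _; rewrite col0_kd0 /kcol !scalerBr !scalerA.
  have [e|ne] := eqVneq (alpha j) j; first by rewrite F4 ?alphaK // scaler0 subr0.
  by rewrite /arr (unt_unt0 _ _ _ (j' := alpha j)) ?scale0r ?subr0 // eq_sym.
under eq_bigr => j _ do rewrite E.
rewrite sumrB (reindex_inj (@perm_inj _ z)) /= -sumrB; apply: eq_bigr => c _.
rewrite zpred_zeta -sumrB (bigD1 c) //= big1 ?addr0 => [|i ic].
  by rewrite (unt_ge R (leqnn c)) mul0r scale0r subr0.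
have [->|cm] := eqVneq c ord_max; first by rewrite F2 ?kdom_max // !scaler0 subr0.
case: (ltngtP i c) => h; last by case/eqP: ic; apply: val_inj.
  by rewrite unt_unt ?subrr // val_zeta.
by rewrite F3 // !scaler0 subr0.
Qed.

Section LiftColumns.
Variables (D : pred 'I_n.+1) (t : 'I_n.+1 -> 'I_n.+1) (h : 'I_n.+1 -> 'I_n.+1 -> M).

(** The lift of a prescribed family of first columns whose second columns vanish
    off the forced diagonal entry. *)
Definition nlift : colmod R M := col_of R (fun i c b =>
  if b then (if (alpha c != c) && (i == alpha c) then h c c else 0) else h i c).

Lemma nliftE i c b : entry nlift i c b =
  if b then (if (alpha c != c) && (i == alpha c) then h c c else 0) else h i c.
Proof. exact: entry_col. Qed.

Hypothesis h_idem : forall i c, idem R (t c) *: h i c = h i c.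
Hypothesis h_dom : forall i c, ~~ D c -> h i c = 0.
Hypothesis h_le : forall i c, (c < i)%N -> h i c = 0.

Lemma nlift_pcond : pcond D t nlift.
Proof.
split=> [i c b|i c b nD|i c b|i c e|c e]; rewrite !nliftE.
- by case: b => //; case: ifP; rewrite ?scaler0.
- by rewrite !h_dom //; case: b; rewrite ?if_same.
- case: b => [/=|/h_le //].
  by have [->|ne] := eqVneq i (alpha c); rewrite ?ltnn ?andbF.
- by rewrite e eqxx.
- by move/eqP: e => ->; rewrite eqxx.
Qed.
End LiftColumns.

(** The preimage is the image of [F] under the contracting homotopy that sends
    x tensor m, for a path x, to the sum of x' tensor a tensor x'' m over all
    factorizations x = x' a x'' at an arrow a. *)
Lemma kexact0 (F : kmod 0) : kaug F = 0 -> exists H, kdel 0 H = F.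
Proof.
move=> F0; have pF := pmodP F; have [F1 F2 F3 F4 F5] := pF.
have {}F0 := etrans (esym (kaugE F)) F0.
set G := pval F in F0 F1 F2 F3 F4 F5 pF.
pose S i j := \sum_l unt R j l *: col0 G i l.
have idem_col0 i j : idem R j *: col0 G i j = col0 G i j.
  rewrite /col0; case: ifP => _; rewrite -{2}F1 /ktgt /=; first by rewrite idem_alpha.
  by rewrite alphaK.
have S_split i j : S i j = arr j *: (col0 G i (z j) + S i (z j)).
  have [->|jm] := eqVneq j ord_max.
    rewrite arr_max scale0r /S big1 // => l _.
    by rewrite unt_ge ?scale0r // -ltnS ltn_ord.
  rewrite {1}/S (bigD1 (z j)) //= scalerDr; congr (_ + _).
  rewrite /S scaler_sumr [RHS](bigD1 (z j)) //= unt_ge // scale0r scaler0 add0r.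
  apply: eq_bigr => l lz; rewrite scalerA; case: (ltnP j l) => jl.
    by rewrite (unt_split jl) (negPf lz).
  by rewrite !unt_ge ?mulr0 // val_zeta // leqW.
pose h i c := if (c != ord_max) && (i <= c)%N
  then col0 G i (z c) + S i (z c) else 0.
have h_idem i c : idem R (ktgt 1 c) *: h i c = h i c.
  rewrite /h ktgt1; case: ifP => _; last by rewrite scaler0.
  rewrite scalerDr idem_col0 /S scaler_sumr; congr (_ + _).
  by apply: eq_bigr => l _; rewrite scalerA idem_unt.
have h_dom i c : ~~ kdom 1 c -> h i c = 0.
  by rewrite kdom1 /h => /negPf ->.
have h_le i c : (c < i)%N -> h i c = 0.
  by move=> ci; rewrite /h (leqNgt i) ci andbF.
have arr_h i j : (i <= j)%N -> arr j *: h i j = S i j.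
  move=> ij; rewrite /h ij andbT; case: eqVneq => [->|_]; last by rewrite [RHS]S_split.
  by rewrite [RHS]S_split arr_max !scale0r.
have h_prev i j : h i (zpred j) = if (i < j)%N then col0 G i j + S i j else 0.
  rewrite /h zpred_max zeta_zpred; have [->|j0] //= := eqVneq j ord0.
  by rewrite -[in RHS](val_zpred j0) ltnS.
have aug_j j : col0 G j j + S j j + (if alpha j == j then 0 else S (alpha j) (alpha j)) = 0.
  have A1 : idem R j *: (\sum_(c < n.+1 | (c <= alpha c)%N) idem R c *: entry G c c false)
      = col0 G j j.
    pose r := if (j <= alpha j)%N then j else alpha j.
    have rr : (r <= alpha r)%N by rewrite /r; case: (leqP j) => // h'; rewrite alphaK ltnW.
    have rj : idem R j * idem R r = idem R j.
      by rewrite idem_idem // /r; case: leqP; rewrite eqxx ?orbT.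
    rewrite scaler_sumr (bigD1 r) //= big1 ?addr0 => [|c /andP[cc cr]].
      rewrite scalerA rj -(idem_col0 j j); congr (_ *: _).
      rewrite /r /col0; case: leqP => // h'; rewrite -F5 ?alphaK // => e.
      by rewrite -e ltnn in h'.
    rewrite scalerA idem_idem //; case: ifP => [/orP h'|]; last by rewrite scale0r.
    case/eqP: cr; rewrite /r; case: h' => /eqP e; rewrite e ?alphaK in cc *; first by rewrite cc.
    by case: leqP => // h'; apply: val_inj; apply/eqP; rewrite eqn_leq cc h'.
  have A2 : idem R j *: (\sum_l \sum_i unt R i l *: col0 G i l) =
      S j j + (if alpha j == j then 0 else S (alpha j) (alpha j)).
    have idem_S i : idem R j *: S i i = if (i == j) || (i == alpha j) then S i i else 0.
      rewrite /S scaler_sumr; case: ifP => [h'|/negbT h'].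
        apply: eq_bigr => l _; rewrite scalerA; case/orP: h' => /eqP ->.
          by rewrite idem_unt.
        by rewrite idem_alpha_unt.
      rewrite big1 // => l _; rewrite scalerA -(idem_unt R i l) mulrA idem_idem //.
      by rewrite (negPf h') mul0r scale0r.
    rewrite exchange_big scaler_sumr (eq_bigr _ (fun i _ => idem_S i)) /=.
    rewrite (bigD1 j) //= eqxx; congr (_ + _); rewrite -big_mkcondr /=.
    case: eqP => e; first by rewrite big1 // => i /andP[/negPf ij]; rewrite e ij.
    rewrite (big_pred1 (alpha j)) // => i /=.
    have [->|] := eqVneq i j; last by [].
    by rewrite eq_sym; apply/esym/eqP.
  by have := congr1 ( *:%R (idem R j)) F0; rewrite scaler0 scalerDr A1 A2 addrA.
exists (pmk (nlift_pcond h_idem h_dom h_le)).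
apply: pmod_eq => i c b; rewrite [LHS]kd0E.
have [gd|ngd] := boolP (kguard c b); last first.
  move: ngd; rewrite negb_and negbK => /orP[nd|/andP[bt /eqP ac]]; first by rewrite F2.
  by rewrite bt F4.
have -> : entry F i c b = col0 G i (pos alpha c b).
  case/andP: gd => cc; rewrite /col0; case: b => //=; last by rewrite cc.
  by move=> ne; rewrite alphaK leqNgt ltn_neqAle cc andbT val_eqE eq_sym ne.
set j := pos alpha c b.
rewrite /kcol !nliftE alphaK.
rewrite h_prev; case: (ltngtP i j) => [ij|ji|/val_inj ->].
- have -> : i == j = false by apply/eqP => e; rewrite e ltnn in ij.
  by rewrite (arr_h _ _ (ltnW ij)) andbF scaler0 subr0 addrK.
- have -> : i == j = false by apply/eqP => e; rewrite e ltnn in ji.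
  rewrite (h_le _ _ ji) andbF !scaler0 !subr0 /col0; case: ifP => _; apply/esym.
    exact: (F3 i j false).
  by apply: F3; rewrite /= alphaK.
have /eqP := aug_j j; rewrite -addrA addr_eq0 opprD => /eqP ->.
rewrite arr_h // eqxx andbT sub0r eq_sym; congr (_ - _).
by have [_|_] := eqVneq (alpha j) j; rewrite /= ?scaler0 // arr_h.
Qed.

Lemma arr_arr_entry m t F i j b : pcond (kdom m.+2) t F ->
  (arr j * arr (alpha (z j))) *: entry F i j b = 0.
Proof.
move=> [_ F2 _ _ _]; have [h|h] := boolP (kdom m.+2 j); last by rewrite F2 ?scaler0.
by move: h; rewrite kdomS => /and3P[_ h _]; rewrite arr_arr ?scale0r.
Qed.

Lemma kdel0_kdel1 (F : kmod 2) : kdel 0 (kdel 1 F) = 0.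
Proof.
have pF := pmodP F.
apply: pmod_eq => i c b; rewrite [LHS]kd0E entry0; case: ifP => // _.
set j := pos alpha c b; rewrite /kcol !kdE !ktgt1 zeta_zpred !expr0 !mul1r !addr0 alphaK.
by rewrite scalerDr !scalerA !(arr_arr_entry _ _ _ pF) subr0 add0r subrr.
Qed.

Lemma kdel_kdel m (F : kmod m.+3) : kdel m.+1 (kdel m.+2 F) = 0.
Proof.
have pF := pmodP F; have [_ F2 _ _ _] := pF.
apply: pmod_eq => i c b; rewrite entry0 [LHS]kdE !kdE.
have E l b' : (arr (alpha (ktgt m.+1 l)) * arr (alpha (ktgt m.+2 l))) *: entry (pval F) i l b' = 0.
  have [h|h] := boolP (kdom m.+3 l); last by rewrite F2 ?scaler0.
  by rewrite (ktgtS m.+1) arr_arr ?scale0r //; exact: (ktgt_nonisolated h).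
have comm x y : ((-1) ^+ m * x) * ((-1) ^+ m.+1 * y) = - (x * y) :> A.
  rewrite exprS mulN1r mulNr mulrN; congr (- _).
  by rewrite mulrA -(mulrA _ x) (commr_sign x) mulrA -expr2 sqrr_sign mul1r.
rewrite scalerDr scalerA comm scaleNr E oppr0 add0r.
case: b; last by rewrite scaler0 addr0.
by rewrite addr0 ktgt_zpred -scalerDl exprS mulN1r mulNr addrN scale0r.
Qed.

(** The second column of the summand [alpha (z c)] of [F] is copied to the first
    column of the summand [c] of the preimage.  The differential returns it to
    its place, and the hypothesis says that the first columns are then right
    too. *)
Lemma kexact_lift m (F : kmod m.+1) :
  (forall i c, c != ord_max -> entry (pval F) i c false =
    ((-1) ^+ m * arr (alpha (ktgt m.+1 c))) *: entry (pval F) i (alpha (z c)) true) ->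
  exists H, kdel m.+1 H = F.
Proof.
move=> FE; have [F1 F2 F3 F4 F5] := pmodP F.
pose h i c := if (c != ord_max) && (i <= c)%N
  then entry (pval F) i (alpha (z c)) true else 0.
have h_idem i c : idem R (ktgt m.+2 c) *: h i c = h i c.
  by rewrite /h; case: ifP => _; rewrite ?scaler0 // ktgtSr F1.
have h_dom i c : ~~ kdom m.+2 c -> h i c = 0.
  rewrite kdomS /h; case: eqVneq => //= cm; case: eqVneq => /= [e _|_ nD].
    by rewrite F4 ?if_same // alphaK e.
  by rewrite F2 ?if_same.
have h_le i c : (c < i)%N -> h i c = 0.
  by move=> ci; rewrite /h (leqNgt i) ci andbF.
have arr_h i c : (i <= c)%N ->
    ((-1) ^+ m * arr (alpha (ktgt m.+1 c))) *: h i c = entry (pval F) i c false.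
  move=> ic; rewrite /h ic andbT; case: eqVneq => [->|cm] /=; last by rewrite FE.
  by rewrite scaler0 F2 // kdom_max.
have h_prev i c : h i (zpred (alpha c)) =
    if (i < alpha c)%N then entry (pval F) i c true else 0.
  rewrite /h zpred_max zeta_zpred alphaK; have [->|j0] //= := eqVneq (alpha c) ord0.
  by rewrite -[in RHS](val_zpred j0) ltnS.
exists (pmk (nlift_pcond h_idem h_dom h_le)).
apply: pmod_eq => i c b; rewrite [LHS]kdE !nliftE; case: b; last first.
  rewrite addr0; case: (leqP i c) => ic; first exact: arr_h.
  by rewrite h_le // scaler0 (F3 i c false).
rewrite h_prev; have [->|iac] := eqVneq i (alpha c).
  rewrite ltnn addr0 andbT; have [e|ne] := eqVneq (alpha c) c.
    by rewrite /= scaler0 F4.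
  by rewrite arr_h // F5 //; apply/eqP.
rewrite andbF scaler0 add0r; case: ltnP => // h'.
by apply/esym/(F3 i c true); rewrite /= ltn_neqAle h' andbT eq_sym.
Qed.

(** The cycle condition expresses the first column [c] of [F] by the column [z c]
    and the wanted term.  The term in the column [z c] is killed by descending
    induction, since it can be pushed along [p] until [p] ends. *)
Lemma kexact1 (F : kmod 1) : kdel 0 F = 0 -> exists H, kdel 1 H = F.
Proof.
move=> dF; have [F1 F2 F3 F4 F5] := pmodP F.
have FE i c : entry (pval F) i c false = arr (z c) *: entry (pval F) i (z c) false +
    arr (alpha (z c)) *: entry (pval F) i (alpha (z c)) true.
  have : kcol (pval F) i (z c) = 0.
    rewrite -col0_kd0; have -> : kd0 (pval F) = 0 by have := congr1 (@pval _ _ _ _ _ _ _ _) dF.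
    by rewrite /col0 !entry0 if_same.
  by rewrite /kcol zpred_zeta => /eqP; rewrite subr_eq0 subr_eq addrC => /eqP.
have unt0 i l c : c != ord_max -> unt R l (z c) *: entry (pval F) i c false = 0.
  have [N] := ubnP (n - c)%N; elim: N c l => // N IH c l cN cm.
  have zc := val_zeta cm.
  have [lz|lz] := leqP (z c) l; first by rewrite unt_ge // scale0r.
  rewrite FE scalerDr !scalerA [X in _ + X](_ : _ = 0) ?addr0; last first.
    have [e|ne] := eqVneq (alpha (z c)) (z c); first by rewrite (F4 i) ?scaler0 // alphaK e.
    by rewrite /arr unt_unt0 ?scale0r // eq_sym.
  have [->|zm] := eqVneq (z c) ord_max; first by rewrite arr_max mulr0 scale0r.
  rewrite /arr unt_unt //; last by rewrite (val_zeta zm).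
  by apply: IH => //; rewrite zc; have := ltn_ord (z c); rewrite zc; lia.
apply: kexact_lift => i c cm; rewrite expr0 mul1r ktgt1 {1}FE.
have [->|zm] := eqVneq (z c) ord_max; first by rewrite arr_max scale0r add0r.
by rewrite unt0 ?add0r.
Qed.

Lemma kexact_succ m (F : kmod m.+2) : kdel m.+1 F = 0 -> exists H, kdel m.+2 H = F.
Proof.
move=> dF; apply: kexact_lift => i c cm.
have : entry (kd m (pval F)) i (alpha (z c)) true = 0.
  have -> : kd m (pval F) = 0 by have := congr1 (@pval _ _ _ _ _ _ _ _) dF.
  exact: entry0.
rewrite kdE alphaK zpred_zeta -ktgtSr addrC => /eqP; rewrite addr_eq0 => /eqP ->.
by rewrite exprS mulN1r mulNr scaleNr.
Qed.

Lemma kexact m (F : kmod m.+1) : kdel m F = 0 <-> exists H, kdel m.+1 H = F.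
Proof.
split; first by case: m F => [|m] F; [exact: kexact1|exact: kexact_succ].
by case=> H <-; case: m H {F} => [|m] H; [exact: kdel0_kdel1|exact: kdel_kdel].
Qed.

Lemma kmod_projective m : projective (kmod m).
Proof. exact: projective_pmod. Qed.

Lemma kexact_aug (F : kmod 0) : kaug F = 0 <-> exists H, kdel 0 H = F.
Proof. by split=> [/kexact0 //|[H <-]]; exact: kaug_kdel. Qed.

Definition koszul : resolution M :=
  Resolution kmod_projective kaug_surj kexact_aug kexact.

End Complex.

Lemma pdim_le_koszul (M : lmodType A) d : (forall c, (g c <= d)%N) -> pdim_le M d.
Proof.
move=> gd; apply/pdim_leP; exists (koszul M) => -[//|m] dm F.
have [_ F2 _ _ _] := pmodP F; apply: pmod_eq => i c b; rewrite entry0 F2 //.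
by rewrite /kdom negb_and -leqNgt (leq_trans (gd c)) ?orbT.
Qed.

(** Membership in the radical: the coefficients of all the generators vanish. *)
Definition rad D t (M : lmodType A) (F : pmod R D t M) :=
  forall c, entry (pval F) c c false = 0.

(** The radical is spanned by the products of strictly upper triangular elements
    with generators, hence preserved by linear maps. *)
Lemma linear_rad D t M D' t' N (f : {linear pmod R D t M -> pmod R D' t' N}) F :
  rad F -> rad (f F).
Proof.
move=> F0 c; rewrite linear_gen /ev pval_sum entry_sum big1 // => c' _.
rewrite /evc F0 gen0 linear0 scaler0 add0r pval_sum entry_sum big1 // => b _.
rewrite pval_sum entry_sum big1 // => i _; rewrite pvalZ entry_unt.
case: ifP => // /andP[ij /eqP ci]; have [_ _ F3 _ _] := pmodP (f (gen R D t c' (entry (pval F) i c' b))).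
by rewrite F3 //= ci.
Qed.

Lemma kdel_rad M m (F : kmod M m.+1) :
  (forall j (x : M), arr j *: x = 0) -> rad (kdel M m F).
Proof.
move=> arr0 c; case: m F => [|m] F.
  rewrite [LHS]kd0E /=; case: ifP => // _.
  by rewrite kcol_diag ?arr0 ?if_same ?addr0 ?oppr0 //; exact: pmodP.
by rewrite [LHS]kdE addr0 -scalerA arr0 scaler0.
Qed.

(** The simple module at the vertex of the position [t]. *)
Definition smod (r : tri_rep A alpha) (t : 'I_n.+1) : Type := k.
HB.instance Definition _ r t := GRing.Zmodule.copy (smod r t) k.

Section Simple.
Variable t : 'I_n.+1.

Definition sscale (a : A) (x : smod R t) : smod R t := R a t t * (x : k).

Lemma rho_diagM (a a' : A) : R (a * a') t t = R a t t * R a' t t.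
Proof.
rewrite rhoM (bigD1 t) //= big1 ?addr0 // => l lt.
case: (ltngtP l t) => h.
- by rewrite (rho_tri R a h) mul0r.
- by rewrite [R a' l t](rho_tri R a' h) mulr0.
- by case/eqP: lt; apply: val_inj.
Qed.

Fact sscaleA (a a' : A) x : sscale a (sscale a' x) = sscale (a * a') x.
Proof. by rewrite /sscale rho_diagM mulrA. Qed.
Fact sscale1 : left_id 1 sscale.
Proof. by move=> x; rewrite /sscale rho1 eqxx mul1r. Qed.
Fact sscaleDr : right_distributive sscale +%R.
Proof. by move=> a x y; exact: mulrDr. Qed.
Fact sscaleDl x : {morph sscale^~ x : a a' / a + a'}.
Proof. by move=> a a'; rewrite /sscale rhoD; exact: mulrDl. Qed.
HB.instance Definition _ := GRing.Zmodule_isLmodule.Build A (smod R t)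
  sscaleA sscale1 sscaleDr sscaleDl.

Lemma smodZ (a : A) (x : smod R t) : a *: x = R a t t * (x : k).
Proof. by []. Qed.

Lemma arr_smod j (x : smod R t) : arr j *: x = 0.
Proof.
rewrite smodZ untE; case: and3P => [[jz /eqP tj /eqP e]|_]; last by rewrite mul0r.
by rewrite -e tj ltnn in jz.
Qed.

End Simple.

(** The generator of degree [m.+1] at [c] would be a sum of values of
    differentials and of images of such values, all of which lie in the
    radical. *)
Lemma pdim_simple m c d : kdom m.+1 c -> pdim_le (smod R (ktgt m.+1 c)) d -> (m < d)%N.
Proof.
move=> mc /pdim_leP [r r0]; rewrite ltnNge; apply/negP => dm.
set t := ktgt m.+1 c in r r0 *.
have [h hE] := @res_contraction _ _ r (koszul (smod R t)) d r0.
pose x : kmod (smod R t) m.+1 := gen R (kdom m.+1) (ktgt m.+1) c (1 : smod R t).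
have : rad x.
  rewrite (hE m dm x) => c'; rewrite pvalD entryD.
  rewrite (kdel_rad (h m.+1 x) (@arr_smod t)) add0r.
  by apply: linear_rad; exact: (kdel_rad x (@arr_smod t)).
move=> /(_ c); rewrite genE mc !eqxx /= smodZ idemE eqxx /= mulr1.
by move/eqP; rewrite oner_eq0.
Qed.

End Koszul.

Lemma gldim_tri_rep (k : fieldType) (A : algType k) n (alpha : 'S_n.+1)
    (g : 'I_n.+1 -> nat) :
  tri_rep A alpha -> quasi_diagram alpha -> g_spec alpha g ->
  gldim_is A (\max_c g c).
Proof.
move=> R alphaK gP; split=> [M|d hd].
  by apply: (pdim_le_koszul R alphaK gP) => c; exact: leq_bigmax.
apply/bigmax_leqP => c _; case E: (g c) => [//|m].
apply: (@pdim_simple _ _ _ _ R alphaK g gP m c); last exact: hd.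
rewrite /kdom E leqnn andbT; apply/eqP => e.
by have [g0 _] := gP; rewrite e g0 in E.
Qed.

(** * Combinatorics of the orbit lengths *)

Section Combinatorics.
Variables (n : nat) (alpha : 'S_n.+1).
Hypothesis alphaK : quasi_diagram alpha.
Variables (g d : 'I_n.+1 -> nat).
Hypotheses (gP : g_spec alpha g) (dP : d_spec alpha d).

(** A maximizer [c] that is neither isolated nor [alpha ord0] would have the
    predecessor [zpred (alpha c)], at which g is larger by one. *)
Lemma max_g_starts :
  \max_c g c = \max_(c | isolated alpha c || (c == alpha ord0)) g c.
Proof.
apply/eqP; rewrite eqn_leq; apply/andP; split; last first.
  by apply/bigmax_leqP => c _; exact: leq_bigmax.
have [|c0 c0max] := @eq_bigmax _ g; first by rewrite card_ord.
have [st|/norP[niso nst]] := boolP (isolated alpha c0 || (c0 == alpha ord0)).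
  rewrite c0max.
  exact: (@leq_bigmax_cond _ (fun c => isolated alpha c || (c == alpha ord0)) g).
have [cm|cm] := eqVneq c0 ord_max.
  by have [g0 _] := gP; rewrite c0max cm g0.
pose c := zpred (alpha c0).
have c_max : c != ord_max.
  by rewrite zpred_max; apply: contra nst => /eqP <-; rewrite alphaK.
have := @leq_bigmax _ g c; rewrite c0max (g_step alphaK gP c_max) zeta_zpred alphaK.
rewrite (negPf cm) /= eq_sym -/(isolated alpha c0) (negPf niso) /=.
by rewrite ltnn.
Qed.

(** The iterates of [alpha_zeta] and [zeta_alpha] are conjugate under [alpha],
    which fixes the isolated points and exchanges the two exceptional points. *)
Lemma d_g_alpha i : d i = g (alpha i).
Proof.
have [d0 dp] := dP; have [g0 gp] := gP.
have [e|ne] := eqVneq i (alpha ord_max); first by rewrite e alphaK d0 g0.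
have ne' : alpha i != ord_max by apply: contra ne => /eqP <-; rewrite alphaK.
have it m : iter m (alpha_zeta alpha) (alpha i) = alpha (iter m (zeta_alpha alpha) i).
  by elim: m => //= m ->.
have E m : (let x := iter m (alpha_zeta alpha) (alpha i) in x = ord_max \/ isolated alpha x)
    <-> (let x := iter m (zeta_alpha alpha) i in isolated alpha x \/ x = alpha ord_max).
  rewrite /= it /isolated alphaK; split=> [[<-|]|[|->]]; rewrite ?alphaK; auto.
  - by rewrite eq_sym; left.
  - by rewrite eq_sym; right.
have [d1 d2 d3] := dp i ne; have [g1 g2 g3] := gp _ ne'.
by apply/eqP; rewrite eqn_leq d3 ?g3 //; apply/E.
Qed.

Lemma max_g_max_d :
  \max_(j | isolated alpha j || (j == alpha ord0)) g j =
  \max_(i | isolated alpha i || (i == ord0)) d i.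
Proof.
rewrite (reindex_inj (@perm_inj _ alpha)); apply: eq_big => [i|i _].
  by rewrite /isolated alphaK (inj_eq perm_inj) eq_sym.
by rewrite d_g_alpha.
Qed.

End Combinatorics.

Local Close Scope ring_scope.

Theorem proposition3p5 (k : closedFieldType) (char0 : [pchar k]%R =i pred0)
  (n : nat) (alpha : 'S_n.+1)
  (Hqd : quasi_diagram alpha) (Hreg : regular alpha)
  (A : falgType k) (HA : gentle_one_maximal_path A alpha)
  (g d : 'I_n.+1 -> nat) (Hg : g_spec alpha g) (Hd : d_spec alpha d) :
  gldim_is A (\max_(j | isolated alpha j || (j == alpha ord0)) g j) /\
  \max_(j | isolated alpha j || (j == alpha ord0)) g j
    = \max_(i | isolated alpha i || (i == ord0)) d i.
Proof.
have [R] := gentle_tri_rep HA.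
split; last exact: max_g_max_d.
rewrite -(max_g_starts Hqd Hg); exact: (gldim_tri_rep R Hqd Hg).
Qed.
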